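(* For every positive integer $n$, the AST partition function $Z_n(u_1,\ldots,u_n;u_{n+1})_{\mathrm{AST}}$ is equal to $$\frac{\prod_{j=1}^n\sigma(\bar p u_j)\,\prod_{i=1}^n\prod_{j=1}^{n+1}\sigma(q^2u_iu_j)\,\sigma(q^2 \bar u_i \bar u_j)} {\sigma(q^2)^{2n}\,\sigma(q^4)^{n(n-1)}\,\prod_{i=1}^n\sigma(u_i \bar u_{n+1})\,\prod_{1\le i<j\le n}\sigma(u_i \bar u_j)^2} \;\det_{1\le i,j\le n+1}\left(M_{i,j}\right),$$ where $$M_{i,j}=\begin{cases} \dfrac{1}{\sigma(q^2u_iu_j)\,\sigma(q^2 \bar u_i \bar u_j)},&i\le n,\\[2mm] 1 - \dfrac{\sigma(\bar u_{n+1} u_j)}{\sigma(\bar p u_j)},&i=n+1.\end{cases}$$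
   Context: Here $p,q,u_1,\dots,u_{n+1}$ are indeterminates; write $\bar x=x^{-1}$ and $\sigma(x)=x-\bar x$. Graph. Let $\mathcal T_n$ be the graph with vertices $(0,j)$, $1\le j\le 2n+1$, and $(i,j)$, $1\le i\le n+1$, $i\le j\le 2n+2-i$ (matrix coordinates: $i$ increases downwards, $j$ increases to the right). Vertical edges join $(i-1,j)$ and $(i,j)$ whenever both are vertices; horizontal edges join $(i,j)$ and $(i,j+1)$ whenever both are vertices and $i\ge1$. Bulk vertices: $(i,j)$ with $1\le i\le n$, $i<j<2n+2-i$ (degree 4). Left boundary vertices: $(i,i)$, $1\le i\le n$ (one edge going up, one going right). Right boundary vertices: $(i,2n+2-i)$, $1\le i\le n$ (one edge going up, one going left). The remaining vertices have degree 1. A configuration is an orientation of $\mathcal T_n$ such that each bulk vertex has two incoming and two outgoing edges and each top edge is directed upwards (from $(1,j)$ to $(0,j)$). The label of the bulk vertex $(i,j)$ is $u_iu_{\min(j,2n+2-j)}$, and the label of the boundary vertices $(i,i)$ and $(i,2n+2-i)$ is $u_i$. The weight of a configuration is the product of all vertex weights; degree 1 vertices have weight 1, and the other vertices, with label $u$, have the following weights. Bulk: weight $1$ if both vertical edges are outgoing or both are incoming; $\sigma(q^2u)/\sigma(q^4)$ if both vertical edges point up and both horizontal edges point right, or both vertical edges point down and both horizontal edges point left; $\sigma(q^2\bar u)/\sigma(q^4)$ if both vertical edges point down and both horizontal edges point right, or both vertical edges point up and both horizontal edges point left. Left boundary (AST specialization): vertical edge outgoing and horizontal edge incoming: $\sigma(p\bar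 u)/\sigma(q^2)$; vertical edge incoming and horizontal edge outgoing: $\sigma(pq^2u)/\sigma(q^2)$; both incoming: $0$; both outgoing: $\sigma(q^2u^2)/\sigma(q^2)$. Right boundary (AST specialization): vertical edge outgoing and horizontal edge incoming: $\sigma(\bar pu)/\sigma(q^2)$; vertical edge incoming and horizontal edge outgoing: $\sigma(\bar pq^2\bar u)/\sigma(q^2)$; both incoming: $0$; both outgoing: $\sigma(q^2\bar u^2)/\sigma(q^2)$. $Z_n(u_1,\dots,u_n;u_{n+1})_{\mathrm{AST}}$ is the sum of the weights of all configurations. *)

(* Defs.v *)
From HB Require Import structures.
From mathcomp Require Import all_boot all_order all_algebra.
From mathcomp Require Import mpoly.

Set Implicit Arguments.
Unset Strict Implicit.
Unset Printing Implicit Defensive.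

Import GRing.Theory.
Local Open Scope ring_scope.

(* The ambient field is the field of rational functions in n + 3 variables;
   X_0 is p, X_1 is q, and X_(k+1) is u_k for 1 <= k <= n + 1. *)
Definition ratfun (K : fieldType) (n : nat) : fieldType :=
  {fraction {mpoly K[n.+3]}}.

Definition indet (K : fieldType) (n : nat) (k : nat) : ratfun K n :=
  @tofrac {mpoly K[n.+3]} 'X_(inord k).

Definition p_indet (K : fieldType) (n : nat) : ratfun K n := indet K n 0.

Definition q_indet (K : fieldType) (n : nat) : ratfun K n := indet K n 1.

(* 1-based; only meaningful for 1 <= k <= n + 1 *)
Definition u_indet (K : fieldType) (n : nat) (k : nat) : ratfun K n :=
  indet K n k.+1.

Definition sigma (F : fieldType) (x : F) : F := x - x^-1.

Section Graph.
Local Open Scope nat_scope.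
Variable n : nat.

(* Coordinates (i, j) with 0 <= i <= n + 1 and 0 <= j <= 2n + 1. The graph lives
   on the pairs selected by [vertex]; column 0 contains no vertex. *)
Definition grid : finType := ('I_n.+2 * 'I_(2 * n).+2)%type.

Definition node (i j : nat) : grid := (inord i, inord j).

Definition vertex (x : grid) : bool :=
  let: (i, j) := (nat_of_ord x.1, nat_of_ord x.2) in
  ((i == 0) && (1 <= j <= 2 * n + 1))
  || ((1 <= i <= n + 1) && (i <= j <= 2 * n + 2 - i)).

(* vertical edge with upper endpoint x and lower endpoint y *)
Definition vedge (x y : grid) : bool :=
  [&& vertex x, vertex y, y.1 == x.1.+1 :> nat & y.2 == x.2 :> nat].

(* horizontal edge with left endpoint x and right endpoint y *)
Definition hedge (x y : grid) : bool :=
  [&& vertex x, vertex y, 1 <= x.1, y.1 == x.1 :> nat & y.2 == x.2.+1 :> nat].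

Definition adjacent (x y : grid) : bool :=
  [|| vedge x y, vedge y x, hedge x y | hedge y x].

Definition bulk (x : grid) : bool :=
  let: (i, j) := (nat_of_ord x.1, nat_of_ord x.2) in
  (1 <= i <= n) && (i < j < 2 * n + 2 - i).

Definition left_boundary (x : grid) : bool :=
  let: (i, j) := (nat_of_ord x.1, nat_of_ord x.2) in
  (1 <= i <= n) && (j == i).

Definition right_boundary (x : grid) : bool :=
  let: (i, j) := (nat_of_ord x.1, nat_of_ord x.2) in
  (1 <= i <= n) && (j == 2 * n + 2 - i).

(* An orientation is given by its set A of arcs; (x, y) \in A means that the
   edge between x and y is directed from x to y. *)
Definition orientation (A : {set grid * grid}) : bool :=
  [forall x : grid, forall y : grid,
     if adjacent x y then ((x, y) \in A) (+) ((y, x) \in A)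
     else (x, y) \notin A].

Definition configuration (A : {set grid * grid}) : bool :=
  [&& orientation A,
      [forall x : grid, bulk x ==>
         (#|[set y : grid | (y, x) \in A]| == 2)
         && (#|[set y : grid | (x, y) \in A]| == 2)]
    & [forall x : grid, forall y : grid,
         (x.1 == 0 :> nat) && vedge x y ==> ((y, x) \in A)]].

(* [node] truncates through [inord]; these are only used at vertices (i, j) that
   have the corresponding edge. *)
Definition above_up (A : {set grid * grid}) (i j : nat) : bool :=
  (node i j, node i.-1 j) \in A.
Definition below_up (A : {set grid * grid}) (i j : nat) : bool :=
  (node i.+1 j, node i j) \in A.
Definition left_rightward (A : {set grid * grid}) (i j : nat) : bool :=
  (node i j.-1, node i j) \in A.
Definition right_rightward (A : {set grid * grid}) (i j : nat) : bool :=
  (node i j, node i j.+1) \in A.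

End Graph.

Section Weights.
Variables (F : fieldType) (p q : F).

(* above, below: the edge points up; left, right: the edge points right. The
   last case never occurs at a vertex with two incoming and two outgoing edges. *)
Definition bulk_weight (u : F) (above below left right : bool) : F :=
  match above, below, left, right with
  | true, false, _, _ | false, true, _, _ => 1
  | true, true, true, true | false, false, false, false =>
      sigma (q ^+ 2 * u) / sigma (q ^+ 4)
  | false, false, true, true | true, true, false, false =>
      sigma (q ^+ 2 * u^-1) / sigma (q ^+ 4)
  | _, _, _, _ => 0
  end.

(* In the boundary weights, vout (resp. hout) says that the vertical (resp.
   horizontal) edge is outgoing. *)
Definition left_weight (u : F) (vout hout : bool) : F :=
  match vout, hout with
  | true, false => sigma (p * u^-1) / sigma (q ^+ 2)
  | false, true => sigma (p * q ^+ 2 * u) / sigma (q ^+ 2)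
  | false, false => 0
  | true, true => sigma (q ^+ 2 * u ^+ 2) / sigma (q ^+ 2)
  end.

Definition right_weight (u : F) (vout hout : bool) : F :=
  match vout, hout with
  | true, false => sigma (p^-1 * u) / sigma (q ^+ 2)
  | false, true => sigma (p^-1 * q ^+ 2 * u^-1) / sigma (q ^+ 2)
  | false, false => 0
  | true, true => sigma (q ^+ 2 * u^-1 ^+ 2) / sigma (q ^+ 2)
  end.

Variables (n : nat) (u : nat -> F).

Definition vertex_weight (A : {set grid n * grid n}) (x : grid n) : F :=
  let: (i, j) := (nat_of_ord x.1, nat_of_ord x.2) in
  if bulk x then
    bulk_weight (u i * u (minn j (2 * n + 2 - j)))
      (above_up A i j) (below_up A i j)
      (left_rightward A i j) (right_rightward A i j)
  else if left_boundary x then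
    left_weight (u i) (above_up A i j) (right_rightward A i j)
  else if right_boundary x then
    right_weight (u i) (above_up A i j) (~~ left_rightward A i j)
  else 1.

Definition Z_AST : F :=
  \sum_(A : {set grid n * grid n} | configuration A)
    \prod_(x : grid n | vertex x) vertex_weight A x.

Definition AST_matrix : 'M[F]_n.+1 :=
  \matrix_(i < n.+1, j < n.+1)
    if (i < n)%N then
      1 / (sigma (q ^+ 2 * u i.+1 * u j.+1)
           * sigma (q ^+ 2 * (u i.+1)^-1 * (u j.+1)^-1))
    else
      1 - sigma ((u n.+1)^-1 * u j.+1) / sigma (p^-1 * u j.+1).

End Weights.

(* Main.v *)
Require Import Defs.
From mathcomp Require Import all_boot all_order all_algebra.
From mathcomp Require Import mpoly.
From mathcomp Require Import fingroup perm.
From mathcomp Require Import ring zify.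
Import GRing.Theory.
Local Open Scope ring_scope.
Set Implicit Arguments.
Unset Strict Implicit.
Unset Printing Implicit Defensive.

(** Cut the triangle along its central column. The right half is a covector on
    the [n] rows entering it, and the left half is its mirror image (invert [p]
    and all [u_i], reverse the horizontal edges). The Yang-Baxter and reflection
    equations give an exchange relation for the right half, hence the symmetry
    of the partition function in [u_1, ..., u_n].

    Split the partition function according to the orientation of the bottom edge
    of the central column; each part is a Laurent polynomial in [x = u_(n+1)] of
    definite parity. At [u_1 x = q^2] the top vertex of the central column merely
    reconnects its four edges: the left part of row 1 freezes and, by the exchange
    relation, the central line can be made to reflect at the right wall before it
    crosses any other line. This expresses the two parts at [x = q^2 / u_1] by the
    two parts of size [n - 1] in the parameters [u_2, ..., u_n; u_1]. Expanding the
    determinant along the column of [x] shows that the right-hand side obeys the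
    same recursion. After clearing the denominators both sides vanish at
    [x = u_i], and they agree at [q^2 / u_i] and, by mirror symmetry, at
    [q^-2 / u_1]; these values determine a Laurent polynomial of that degree. *)

(** * Exchange relation, symmetry and reduction *)

(** Without the split by parity the listed values would not suffice: cleared of denominators, the
    whole expression has exponents from -2n to 2n in x, hence 4n+1 unknown coefficients. A part of
    definite parity has 2n+1 of them if the bottom edge points up and 2n if it points down. The
    zeros at u_i and the values at q^2/u_i settle the second part; the first needs one value more,
    the mirror one at q^-2/u_1. In the determinant the same split is that of the last row into 1 and
    the quotient of sigmas. The recursion at q^2/u_1 mixes the two parts and puts u_1 in the place
    of x, so both are treated in a single induction over arbitrary generic parameters. *)

Section SixVertex.
Variables (F : fieldType) (q : F).
Hypotheses (q0 : q != 0) (sq4 : sigma (q ^+ 4) != 0).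

Definition sum_bool (f : bool -> F) : F := f true + f false.

Lemma eq_sum_bool f g : f =1 g -> sum_bool f = sum_bool g.
Proof. by move=> e; rewrite /sum_bool !e. Qed.

Lemma mulr_sum_boolr a f : a * sum_bool f = sum_bool (fun b => a * f b).
Proof. exact: mulrDr. Qed.

(* [c], [b]: the edge below points up, the edge on the left points right;
   [c'], [b']: likewise for the edges above and on the right. With this encoding
   the ice rule is the conservation law [c + b = c' + b']. *)
Definition ice_weight (u : F) (c b c' b' : bool) : F :=
  if (c + b == c' + b')%N then bulk_weight q u c' c b b' else 0.

(** Weight of a vertex whose four edges carry the same state. This is all that remains of an
    exchanging vertex at the top boundary, where both of its lines point up. *)
Definition a_weight (u : F) := sigma (q ^+ 2 * u) / sigma (q ^+ 4).

(* A vertical line with parameter [w] crosses, from bottom to top, horizontal lines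
   with parameters [vs]. The bottom edge is in state [c], the edges on the left are
   in states [s], and [g] is evaluated at the states of the edges on the right and
   at the state of the top edge. Only meaningful if [size s = size vs]. *)
Fixpoint chain (w : F) (vs : seq F) (g : seq bool -> bool -> F)
    (c : bool) (s : seq bool) : F :=
  match vs, s with
  | v :: vs', b :: s' =>
      sum_bool (fun c' => sum_bool (fun b' =>
        ice_weight (w * v) c b c' b' * chain w vs' (fun t => g (b' :: t)) c' s'))
  | _, _ => g s c
  end.

(** The value 0 for a top edge pointing down is the boundary condition of the graph. *)
Definition column w vs (f : seq bool -> F) : bool -> seq bool -> F :=
  chain w vs (fun t c => if c then f t else 0).

(* [us] lists the parameters of the lines from the innermost one (line [n]) outwards,
   [s] the states of the rows where they enter the right half, from bottom to top. *)
Fixpoint right_half (p : F) (us : seq F) (s : seq bool) : F :=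
  match us, s with
  | w :: vs, b :: s' =>
      sum_bool (fun c => right_weight p q w c (~~ b) * column w vs (right_half p vs) c s')
  | _, _ => 1
  end.

Lemma eq_chain w vs g g' c s :
  (forall t d, size t = size s -> g t d = g' t d) ->
  chain w vs g c s = chain w vs g' c s.
Proof.
elim: vs s g g' c => [|v vs IH] [|b s] g g' c e /=; rewrite ?e //.
apply: eq_sum_bool => c'; apply: eq_sum_bool => b'; congr (_ * _).
by apply: IH => t d st; apply: e; rewrite /= st.
Qed.

Lemma chainZ w vs g k c s :
  chain w vs (fun t d => k * g t d) c s = k * chain w vs g c s.
Proof.
elim: vs s g c => [|v vs IH] [|b s] g c //=.
rewrite /sum_bool !IH; ring.
Qed.

Lemma chain_sum_bool w vs (g : bool -> seq bool -> bool -> F) c s :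
  chain w vs (fun t d => sum_bool (fun e => g e t d)) c s =
  sum_bool (fun e => chain w vs (g e) c s).
Proof.
elim: vs s g c => [|v vs IH] [|b s] g c //=.
rewrite /sum_bool; do 4!rewrite (IH s (fun e t => g e (_ :: t))) /sum_bool.
ring.
Qed.

Lemma eq_column w vs f f' c s :
  (forall t, size t = size s -> f t = f' t) ->
  column w vs f c s = column w vs f' c s.
Proof. by move=> e; apply: eq_chain => t [] st; rewrite ?e. Qed.

Lemma columnZ w vs f k c s :
  column w vs (fun t => k * f t) c s = k * column w vs f c s.
Proof.
rewrite -chainZ; apply: eq_chain => t [] _ //=; by rewrite mulr0.
Qed.

Lemma column_sum_bool w vs (f : bool -> seq bool -> F) c s :
  column w vs (fun t => sum_bool (fun e => f e t)) c s =
  sum_bool (fun e => column w vs (f e) c s).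
Proof.
rewrite -chain_sum_bool; apply: eq_chain => t [] _ //=; by rewrite /sum_bool addr0.
Qed.

Lemma q8_neq1 : q ^+ 8 - 1 != 0.
Proof.
apply: contraNneq sq4 => h; rewrite /sigma.
have -> : q ^+ 4 - (q ^+ 4)^-1 = (q ^+ 8 - 1) * (q ^+ 4)^-1.
  by field.
by rewrite h mul0r.
Qed.

(** A second shape of the inequality, supplied together with the first for the side conditions of
    [field]. *)
Lemma qq8_neq1 : (q * q) ^+ 4 - 1 != 0.
Proof. by rewrite -expr2 -exprM q8_neq1. Qed.

Lemma q4_neq1 : q ^+ 4 - 1 != 0.
Proof.
apply: contraNneq q8_neq1 => h.
have -> : q ^+ 8 - 1 = (q ^+ 4 - 1) * (q ^+ 4 + 1) by ring.
by rewrite h mul0r.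
Qed.

Lemma qq4_neq1 : (q * q) ^+ 2 - 1 != 0.
Proof. by rewrite -expr2 -exprM q4_neq1. Qed.

Lemma sigma_q2_neq0 : sigma (q ^+ 2) != 0.
Proof.
rewrite /sigma; have -> : q ^+ 2 - (q ^+ 2)^-1 = (q ^+ 4 - 1) * (q ^+ 2)^-1.
  by field.
by rewrite mulf_neq0 ?q4_neq1 // invr_neq0 // expf_neq0.
Qed.

(* A vertex with label [q^2 v1 / v2] exchanges two parallel lines with parameters
   [v1] and [v2]. *)
Lemma yang_baxter_row (w v1 v2 : F) c b1 b2 c' d1 d2 :
  w != 0 -> v1 != 0 -> v2 != 0 ->
  let z := q ^+ 2 * v1 * v2^-1 in
  sum_bool (fun e2 => sum_bool (fun e1 => ice_weight z b1 b2 e2 e1 *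
    sum_bool (fun c1 => ice_weight (w * v1) c e1 c1 d1 * ice_weight (w * v2) c1 e2 c' d2))) =
  sum_bool (fun c1 => sum_bool (fun e1 => ice_weight (w * v2) c b1 c1 e1 *
    sum_bool (fun e2 => ice_weight (w * v1) c1 b2 c' e2 * ice_weight z e1 e2 d2 d1))).
Proof.
move=> w0 v10 v20 /=; have [q8' q8''] := (q8_neq1, qq8_neq1).
rewrite /sum_bool /ice_weight /bulk_weight /sigma.
(* Where the six outer states violate conservation both sides are 0; each of the others is an
   identity of rational functions. *)
case: c b1 b2 c' d1 d2 => [] [] [] [] [] [] /=;
  rewrite ?(mul0r, mulr0, addr0, add0r) //.
all: by field; rewrite ?q0 ?q8' ?q8'' ?w0 ?v10 ?v20.
Qed.

(** The exchange for two vertical lines; it carries the exchanging vertex upwards along two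
    neighbouring columns. *)
Lemma yang_baxter_col (v v1 v2 : F) b c1 c2 c1' c2' b'' :
  v != 0 -> v1 != 0 -> v2 != 0 ->
  let z := q ^+ 2 * v1 * v2^-1 in
  sum_bool (fun o1 => sum_bool (fun o2 => ice_weight z c2 c1 o1 o2 *
    sum_bool (fun b' => ice_weight (v1 * v) o1 b c1' b' * ice_weight (v2 * v) o2 b' c2' b''))) =
  sum_bool (fun o1 => sum_bool (fun b' => ice_weight (v2 * v) c1 b o1 b' *
    sum_bool (fun o2 => ice_weight (v1 * v) c2 b' o2 b'' * ice_weight z o2 o1 c1' c2'))).
Proof.
move=> w0 v10 v20 /=; have [q8' q8''] := (q8_neq1, qq8_neq1).
rewrite /sum_bool /ice_weight /bulk_weight /sigma.
case: b c1 c2 c1' c2' b'' => [] [] [] [] [] [] /=;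
  rewrite ?(mul0r, mulr0, addr0, add0r) //.
all: by field; rewrite ?q0 ?q8' ?q8'' ?w0 ?v10 ?v20.
Qed.

(** Boundary form of the exchange: two lines turn upwards at the right wall, and the exchanging
    vertex passes from their horizontal to their vertical parts. For the given boundary weights this
    is checked on the 16 outer states. *)
Lemma reflection (p v1 v2 : F) b1 b2 c1 c2 :
  p != 0 -> v1 != 0 -> v2 != 0 ->
  let z := q ^+ 2 * v1 * v2^-1 in
  let K := fun v b c => right_weight p q v c (~~ b) in
  sum_bool (fun e2 => sum_bool (fun e1 => ice_weight z b1 b2 e2 e1 *
    sum_bool (fun d => K v1 e1 d * sum_bool (fun f => ice_weight (v1 * v2) d e2 c1 f * K v2
        f c2)))) =
  sum_bool (fun d => K v2 b1 d * sum_bool (fun o1 => sum_bool (fun f =>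
    ice_weight (v2 * v1) d b2 o1 f * sum_bool (fun o2 => K v1 f o2 * ice_weight z o2 o1 c1
        c2)))).
Proof.
move=> p0 v10 v20 /=; have [q8' q8''] := (q8_neq1, qq8_neq1); have [q4' q4''] := (q4_neq1,
    qq4_neq1).
rewrite /sum_bool /ice_weight /bulk_weight /right_weight /sigma.
case: b1 b2 c1 c2 => [] [] [] [] /=;
  rewrite ?(mul0r, mulr0, addr0, add0r) //.
all: field.
all: rewrite ?q0 ?q8' ?q8'' ?q4' ?q4'' ?p0 ?v10 ?v20 //.
Qed.

(** Starting below two neighbouring columns, the exchanging vertex climbs row by row; at the top
    both edges point up, so it leaves the scalar [a_weight z]. *)
Lemma column_exchange v1 v2 vs f c1 c2 s :
  v1 != 0 -> v2 != 0 -> 0 \notin vs ->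
  let z := q ^+ 2 * v1 * v2^-1 in
  sum_bool (fun o1 => sum_bool (fun o2 => ice_weight z c2 c1 o1 o2 *
     column v1 vs (column v2 vs f o2) o1 s)) =
  a_weight z * column v2 vs (column v1 vs f c2) c1 s.
Proof.
move=> v10 v20 /= vs0; elim: vs vs0 s f c1 c2 => [|v vs IH] vs0 s f c1 c2.
  rewrite /column /= /ice_weight /a_weight /bulk_weight /sum_bool.
  by case: c1 c2 => [] [] /=; rewrite ?(mulr0, mul0r, addr0).
(* An empty [s] stops [chain] just as an empty [vs] does. *)
case: s => [|b s].
  rewrite /column /= /ice_weight /a_weight /bulk_weight /sum_bool.
  by case: c1 c2 => [] [] /=; rewrite ?(mulr0, mul0r, addr0).
move: vs0; rewrite inE eq_sym => /norP[v0 vs0].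
have E x y d1 d2 : column x (v :: vs) (column y (v :: vs) f d2) d1 (b :: s) =
  sum_bool (fun c' => sum_bool (fun b' => ice_weight (x * v) d1 b c' b' *
   sum_bool (fun d' => sum_bool (fun b'' => ice_weight (y * v) d2 b' d' b'' *
     column x vs (column y vs (fun t => f (b'' :: t)) d') c' s)))).
  rewrite /column /=; apply: eq_sum_bool => c'; apply: eq_sum_bool => b'.
  congr (_ * _); rewrite -/(column y vs _).
  transitivity (column x vs (fun t =>
      sum_bool (fun d' => sum_bool (fun b'' => ice_weight (y * v) d2 b' d' b'' *
        column y vs (fun t => f (b'' :: t)) d' t))) c' s) => //.
  rewrite column_sum_bool; apply: eq_sum_bool => d'.
  rewrite column_sum_bool; apply: eq_sum_bool => b''.
  by rewrite columnZ.
pose Y o1 o2 b'' := column v1 vs (column v2 vs (fun t => f (b'' :: t)) o2) o1 s.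
pose Y' o1 o2 b'' := column v2 vs (column v1 vs (fun t => f (b'' :: t)) o2) o1 s.
have IH' b'' d1 d2 := IH vs0 s (fun t => f (b'' :: t)) d1 d2.
have YB := yang_baxter_col b c1 c2 _ _ _ v0 v10 v20.
set z := q ^+ 2 * v1 * v2^-1 in IH' YB *.
(* Grouped by the states above the lowest row, the inner sum is the left-hand side of the exchange
   across that row. *)
transitivity (sum_bool (fun c1' => sum_bool (fun c2' => sum_bool (fun b'' =>
   sum_bool (fun o1 => sum_bool (fun o2 => ice_weight z c2 c1 o1 o2 *
    sum_bool (fun b' => ice_weight (v1 * v) o1 b c1' b' * ice_weight (v2 * v) o2 b' c2' b''))) *
   Y c1' c2' b'')))).
  under eq_sum_bool => o1 do under eq_sum_bool => o2 do rewrite E.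
  rewrite /sum_bool /Y; ring.
under eq_sum_bool => c1' do under eq_sum_bool => c2' do under eq_sum_bool => b'' do rewrite YB.
transitivity (sum_bool (fun o1 => sum_bool (fun b' => ice_weight (v2 * v) c1 b o1 b' *
    sum_bool (fun o2 => sum_bool (fun b'' => ice_weight (v1 * v) c2 b' o2 b'' *
      (a_weight z * Y' o1 o2 b'')))))).
  under [RHS]eq_sum_bool => o1 do under eq_sum_bool => b' do under eq_sum_bool => o2 do
    under eq_sum_bool => b'' do rewrite -IH'.
  rewrite /sum_bool /Y; ring.
rewrite E /sum_bool /Y'; ring.
Qed.

(** [g] and [g'] stand for everything to the right of the vertical line. If an exchanging vertex
    placed there is absorbed, then so is one placed to the left of the line, by moving it across. *)
Lemma chain_swap w a b l vs g g' c pre b1 b2 s :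
  w != 0 -> a != 0 -> b != 0 -> let z := q ^+ 2 * a * b^-1 in
  (forall t1 d1 d2 t e, size t1 = size l ->
    sum_bool (fun e2 => sum_bool (fun e1 => ice_weight z d1 d2 e2 e1 * g (t1 ++ e1 :: e2 ::
        t) e))
    = g' (t1 ++ d1 :: d2 :: t) e) ->
  size pre = size l ->
  sum_bool (fun e2 => sum_bool (fun e1 =>
    ice_weight z b1 b2 e2 e1 * chain w (l ++ a :: b :: vs) g c (pre ++ e1 :: e2 :: s))) =
  chain w (l ++ b :: a :: vs) g' c (pre ++ b1 :: b2 :: s).
Proof.
move=> w0 a0 b0 /=; set z := q ^+ 2 * a * b^-1.
elim: l pre g g' c => [|x l IH] [|y pre] g g' c // gg'; last first.
  move=> [sz] /=.
  have H c' b' := IH pre (fun t => g (b' :: t)) (fun t => g' (b' :: t)) c'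
    (fun t1 d1 d2 t e st => gg' (b' :: t1) d1 d2 t e (congr1 succn st)) sz.
  under [RHS]eq_sum_bool => c' do under eq_sum_bool => b' do rewrite -H.
  rewrite /sum_bool; ring.
move=> _ /=.
pose Y d1 d2 c' := chain w vs (fun t => g (d1 :: d2 :: t)) c' s.
have YB := yang_baxter_row c b1 b2 _ _ _ w0 a0 b0.
have E d1 d2 c' : chain w vs (fun t => g' (d1 :: d2 :: t)) c' s =
    sum_bool (fun e2 => sum_bool (fun e1 => ice_weight z d1 d2 e2 e1 * Y e1 e2 c')).
  rewrite (@eq_chain _ _ _ (fun t d => sum_bool (fun e2 => sum_bool (fun e1 =>
      ice_weight z d1 d2 e2 e1 * g (e1 :: e2 :: t) d)))); last first.
    by move=> t d _; rewrite -(gg' [::]).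
  rewrite chain_sum_bool; apply: eq_sum_bool => e2.
  rewrite chain_sum_bool; apply: eq_sum_bool => e1.
  by rewrite chainZ.
under [RHS]eq_sum_bool => c1 do under eq_sum_bool => d1 do under eq_sum_bool => c' do
  under eq_sum_bool => d2 do rewrite E.
transitivity (sum_bool (fun c' => sum_bool (fun d2 => sum_bool (fun d1 =>
   sum_bool (fun e2 => sum_bool (fun e1 => ice_weight z b1 b2 e2 e1 *
    sum_bool (fun c1 => ice_weight (w * a) c e1 c1 d1 * ice_weight (w * b) c1 e2 c' d2))) *
   Y d1 d2 c')))).
  rewrite /sum_bool /Y; ring.
under eq_sum_bool => c' do under eq_sum_bool => d2 do under eq_sum_bool => d1 do rewrite YB.
rewrite /sum_bool; ring.
Qed.

(** Isolates the two boundary vertices and the crossing of the two innermost lines, the triple on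
    which [reflection] acts. *)
Lemma right_half_cons2 p v1 v2 vs b1 b2 s :
  let K := fun v b c => right_weight p q v c (~~ b) in
  right_half p (v1 :: v2 :: vs) (b1 :: b2 :: s) =
  sum_bool (fun d => K v1 b1 d * sum_bool (fun c' => sum_bool (fun f =>
    ice_weight (v1 * v2) d b2 c' f * sum_bool (fun c2 => K v2 f c2 *
      column v1 vs (column v2 vs (right_half p vs) c2) c' s)))).
Proof.
rewrite /=; apply: eq_sum_bool => d; congr (_ * _); rewrite /column /=.
apply: eq_sum_bool => c'; apply: eq_sum_bool => f; congr (_ * _).
under [RHS]eq_sum_bool => c2 do rewrite -columnZ.
by rewrite -column_sum_bool.
Qed.

(** The exchanging vertex travels right through the columns of the lines inside the pair, is turned
    upwards at the wall by [reflection], and dissolves at the top by [column_exchange]. *)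
Lemma right_half_swap p l a b vs pre b1 b2 s :
  p != 0 -> 0 \notin l ++ [:: a, b & vs] -> size pre = size l ->
  let z := q ^+ 2 * a * b^-1 in
  sum_bool (fun e2 => sum_bool (fun e1 =>
    ice_weight z b1 b2 e2 e1 * right_half p (l ++ a :: b :: vs) (pre ++ e1 :: e2 :: s))) =
  a_weight z * right_half p (l ++ b :: a :: vs) (pre ++ b1 :: b2 :: s).
Proof.
move=> p0 /=; elim: l pre b1 b2 s => [|x l IH] [|y pre] b1 b2 s //; last first.
  rewrite [(x :: l) ++ _]/= inE mem_cat !inE !negb_or !(eq_sym 0).
  move=> /and5P[x0 l0 a0 b0 vs0] [sz].
  have lv0 : 0 \notin l ++ [:: a, b & vs].
    by rewrite mem_cat !inE !negb_or !(eq_sym 0) l0 a0 b0 vs0.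
  have H c : sum_bool (fun e2 => sum_bool (fun e1 => ice_weight (q ^+ 2 * a * b^-1) b1 b2
      e2 e1 *
       column x (l ++ a :: b :: vs) (right_half p (l ++ a :: b :: vs)) c (pre ++ e1 :: e2
          :: s)))
     = a_weight (q ^+ 2 * a * b^-1) *
       column x (l ++ b :: a :: vs) (right_half p (l ++ b :: a :: vs)) c (pre ++ b1 :: b2 :: s).
    rewrite -columnZ; apply: chain_swap => // t1 d1 d2 t [] st; last first.
      by rewrite /sum_bool; ring.
    by rewrite IH.
  rewrite /= mulr_sum_boolr.
  transitivity (sum_bool (fun c => right_weight p q x c (~~ y) * (a_weight (q ^+ 2 * a * b^-1) *
       column x (l ++ b :: a :: vs) (right_half p (l ++ b :: a :: vs)) c (pre ++ b1 :: b2
          :: s)))).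
    under [RHS]eq_sum_bool => c do rewrite -H.
    rewrite /sum_bool; ring.
  rewrite /sum_bool; ring.
rewrite !cat0s !inE !negb_or !(eq_sym 0) => /and3P[a0 b0 vs0] _.
set z := q ^+ 2 * a * b^-1.
pose Y c' c2 := column a vs (column b vs (right_half p vs) c2) c' s.
have RE c1 c2 := reflection b1 b2 c1 c2 p0 a0 b0.
have CE c1 c2 := column_exchange (right_half p vs) c1 c2 s a0 b0 vs0.
rewrite -/z in RE CE.
under eq_sum_bool => e2 do under eq_sum_bool => e1 do rewrite right_half_cons2.
rewrite right_half_cons2.
transitivity (sum_bool (fun c1 => sum_bool (fun c2 => sum_bool (fun e2 => sum_bool (fun e1
    => ice_weight z b1 b2 e2 e1 *
    sum_bool (fun d => right_weight p q a d (~~ e1) *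
     sum_bool (fun f => ice_weight (a * b) d e2 c1 f * right_weight p q b c2 (~~ f))))) * Y
         c1 c2))).
  rewrite /sum_bool /Y; ring.
under eq_sum_bool => c1 do under eq_sum_bool => c2 do rewrite RE.
transitivity (sum_bool (fun d => right_weight p q b d (~~ b1) * sum_bool (fun c' =>
    sum_bool (fun f =>
    ice_weight (b * a) d b2 c' f * sum_bool (fun c2 => right_weight p q a c2 (~~ f) *
      (a_weight z * column b vs (column a vs (right_half p vs) c2) c' s)))))).
  under [RHS]eq_sum_bool => d do under eq_sum_bool => c' do under eq_sum_bool => f do
    under eq_sum_bool => c2 do rewrite -CE.
  rewrite /sum_bool /Y; ring.
rewrite /sum_bool; ring.
Qed.

(** * The two parts of the partition function *)

Fixpoint sum_states n (f : seq bool -> F) : F :=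
  if n is n'.+1 then sum_bool (fun b => sum_states n' (fun t => f (b :: t))) else f [::].

Lemma eq_sum_states n f g :
  (forall s, size s = n -> f s = g s) -> sum_states n f = sum_states n g.
Proof.
elim: n f g => [|n IH] f g e /=; first exact: e.
by apply: eq_sum_bool => b; apply: IH => s sn; apply: e; rewrite /= sn.
Qed.

Lemma sum_states_cat m n f :
  sum_states (m + n) f = sum_states m (fun t => sum_states n (fun s => f (t ++ s))).
Proof.
elim: m f => [|m IH] f //=.
by apply: eq_sum_bool => b; rewrite IH.
Qed.

Lemma sum_states_bool n (f : bool -> seq bool -> F) :
  sum_states n (fun s => sum_bool (fun b => f b s)) = sum_bool (fun b => sum_states n (f b)).
Proof.
elim: n f => [|n IH] f //=.
rewrite /sum_bool; do 2!rewrite (IH (fun b t => f b (_ :: t))) /sum_bool.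
ring.
Qed.

Lemma sum_statesZ n k f : sum_states n (fun s => k * f s) = k * sum_states n f.
Proof. by elim: n f => [|n IH] f //=; rewrite /sum_bool !IH mulrDr. Qed.

Lemma sum_statesSS n f : sum_states n.+2 f =
  sum_states n (fun s => sum_bool (fun b1 => sum_bool (fun b2 => f (b1 :: b2 :: s)))).
Proof.
rewrite sum_states_bool; apply: eq_sum_bool => b1; by rewrite sum_states_bool.
Qed.

Lemma sum_states_negb n f : sum_states n (fun s => f (map negb s)) = sum_states n f.
Proof.
elim: n f => [|n IH] f //=.
rewrite /sum_bool (IH (fun t => f (false :: t))) (IH (fun t => f (true :: t))).
exact: addrC.
Qed.

(* [e] is the state of the bottom edge of the central column. *)
Definition Z_end (p x : F) (us : seq F) (e : bool) : F :=
  sum_states (size us) (fun s => column x us (right_half p us) e s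
     * right_half p^-1 (map GRing.inv us) (map negb s)).

(** Seen from the left half, the exchanging vertex has its two sides interchanged and its states
    negated. *)
Lemma ice_weight_negb z b1 b2 e2 e1 :
  ice_weight z b1 b2 e2 e1 = ice_weight z (~~ e1) (~~ e2) (~~ b2) (~~ b1).
Proof. by case: b1 b2 e2 e1 => [] [] [] []. Qed.

(** Reflection in a vertical axis interchanges the two weights of straight lines, hence inverts the
    label. This is why the left half is a [right_half] with inverted parameters. *)
Lemma ice_weight_mirror z c b c' b' : ice_weight z c b c' b' = ice_weight z^-1 c (~~ b') c'
    (~~ b).
Proof. by rewrite /ice_weight /bulk_weight invrK; case: c b c' b' => [] [] [] []. Qed.

(* The exchanging vertex is created at the right half, moved through the central
   column and absorbed by the left half. *)
Lemma Z_end_swap p x l a b vs e :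
  p != 0 -> x != 0 -> 0 \notin l ++ [:: a, b & vs] ->
  a_weight (q ^+ 2 * a * b^-1) != 0 ->
  Z_end p x (l ++ a :: b :: vs) e = Z_end p x (l ++ b :: a :: vs) e.
Proof.
move=> p0 x0 lv0 z0; apply: (mulfI z0).
have [a0 b0] : a != 0 /\ b != 0.
  by move: lv0; rewrite mem_cat !inE !negb_or !(eq_sym 0) => /and4P[].
rewrite /Z_end !size_cat !sum_states_cat -!sum_statesZ.
have lv0' : 0 \notin map GRing.inv l ++ [:: b^-1, a^-1 & map GRing.inv vs].
  apply: contra lv0 => h; rewrite -(mem_map (@invr_inj F)) invr0 map_cat /=.
  by move: h; rewrite !mem_cat !inE (orbCA (0 == b^-1)).
apply: eq_sum_states => pre spre; rewrite !sum_statesSS -!sum_statesZ.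
apply: eq_sum_states => s ss.
set z := q ^+ 2 * a * b^-1 in z0 *.
pose C b1 b2 := column x (l ++ a :: b :: vs) (right_half p (l ++ a :: b :: vs)) e
  (pre ++ b1 :: b2 :: s).
pose D b1 b2 := column x (l ++ b :: a :: vs) (right_half p (l ++ b :: a :: vs)) e
  (pre ++ b1 :: b2 :: s).
pose Li b1 b2 := right_half p^-1 (map GRing.inv (l ++ a :: b :: vs))
  (map negb (pre ++ b1 :: b2 :: s)).
pose Lj b1 b2 := right_half p^-1 (map GRing.inv (l ++ b :: a :: vs))
  (map negb (pre ++ b1 :: b2 :: s)).
have HC b1 b2 : sum_bool (fun e2 => sum_bool (fun e1 => ice_weight z b1 b2 e2 e1 * C e1 e2))
    = a_weight z * D b1 b2.
  rewrite -columnZ; apply: chain_swap => // t1 d1 d2 t [] st; last first.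
    by rewrite /sum_bool; ring.
  by rewrite right_half_swap.
have HL b1 b2 : sum_bool (fun e2 => sum_bool (fun e1 => ice_weight z e1 e2 b2 b1 * Lj e1 e2))
    = a_weight z * Li b1 b2.
  rewrite /Li /Lj !map_cat /=.
  (* The inverted parameters are exchanged in the opposite order: [q ^+ 2 * b^-1 / a^-1] is again
     the label [z]. *)
  have := @right_half_swap p^-1 (map GRing.inv l) b^-1 a^-1
     (map GRing.inv vs) (map negb pre) (~~ b1) (~~ b2) (map negb s).
  rewrite invrK mulrAC -/z => <- //; rewrite ?invr_eq0 ?size_map //.
  by rewrite /sum_bool !map_cat /= !(ice_weight_negb z (~~ b1)) !negbK /=; ring.
transitivity (sum_bool (fun b1 => sum_bool (fun b2 => C b1 b2 * (a_weight z * Li b1 b2)))).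
  rewrite /sum_bool /C /Li; ring.
transitivity (sum_bool (fun b1 => sum_bool (fun b2 => a_weight z * D b1 b2 * Lj b1 b2)));
    last first.
  rewrite /sum_bool /D /Lj; ring.
under eq_sum_bool => b1 do under eq_sum_bool => b2 do rewrite -HL.
under [RHS]eq_sum_bool => b1 do under eq_sum_bool => b2 do rewrite -HC.
rewrite /sum_bool; ring.
Qed.

Lemma chain_rcons w vs u g c s b : size s = size vs ->
  chain w (vs ++ [:: u]) g c (s ++ [:: b]) =
  chain w vs (fun t c' => sum_bool (fun c'' => sum_bool (fun b'' =>
    ice_weight (w * u) c' b c'' b'' * g (t ++ [:: b'']) c''))) c s.
Proof.
elim: vs s g c => [|v vs IH] [|d s] g c //= [ss].
by apply: eq_sum_bool => c'; apply: eq_sum_bool => b'; rewrite IH.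
Qed.

(** Since the top edge points up, the ice rule propagates a leftward edge of the outermost row from
    the left of the vertex to its right. *)
Lemma column_frozen w vs u f c s : size s = size vs ->
  column w (vs ++ [:: u]) f c (s ++ [:: false]) =
  a_weight ((w * u)^-1) * column w vs (fun t => f (t ++ [:: false])) c s.
Proof.
move=> ss; rewrite /column chain_rcons // -chainZ.
apply: eq_chain => t [] _; rewrite /sum_bool /ice_weight /bulk_weight /a_weight /=; ring.
Qed.

(** The leftward state runs along the whole outermost row to the wall, where both edges are
    outgoing. In the reduction this is applied to the left half. *)
Lemma right_half_frozen p vs u s : size s = size vs ->
  right_half p (vs ++ [:: u]) (s ++ [:: false]) =
  (\prod_(v <- vs) a_weight ((v * u)^-1)) * (sigma (q ^+ 2 * u^-1 ^+ 2) / sigma (q ^+ 2))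
    * right_half p vs s.
Proof.
elim: vs s => [|v vs IH] [|b s] //= => [_|[ss]].
  rewrite big_nil /sum_bool /column /=; ring.
set k := \prod_(_ <- _) _ * _ in IH *.
have H c : column v (vs ++ [:: u]) (right_half p (vs ++ [:: u])) c (s ++ [:: false]) =
   a_weight ((v * u)^-1) * (\prod_(v <- vs) a_weight ((v * u)^-1) * (sigma (q ^+ 2 * u^-1
       ^+ 2) / sigma (q ^+ 2)) * column v vs (right_half p vs) c s).
  rewrite column_frozen // -[in RHS]columnZ; congr (_ * _); apply: eq_column => t st.
  by rewrite IH // st.
under eq_sum_bool => c do rewrite H.
rewrite /k big_cons /sum_bool; ring.
Qed.

(* The parameter [q^2 / u] turns every crossing on the way into an exchanging vertex. *)
Lemma right_half_move p l vs u pre c s : u != 0 -> p != 0 ->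
  0 \notin l ++ vs -> size pre = size l -> size s = size vs ->
  chain (q ^+ 2 * u^-1) vs
    (fun t c' => right_half p (l ++ vs ++ [:: u]) (pre ++ t ++ [:: c'])) c s =
  \prod_(v <- vs) a_weight (q ^+ 2 * v * u^-1) * right_half p (l ++ u :: vs) (pre ++ c :: s).
Proof.
move=> u0 p0; elim: vs l pre c s => [|v vs IH] l pre c [|b s] //= lv0 spre => [_|[ss]].
  by rewrite big_nil mul1r.
have lv0' : 0 \notin l ++ [:: v, u & vs].
  move: lv0; rewrite !mem_cat !inE !negb_or => /and3P[-> -> ->].
  by rewrite eq_sym u0.
rewrite big_cons [RHS]mulrAC -(right_half_swap _ _ _ p0 lv0' spre) [RHS]mulrC.
rewrite mulr_sum_boolr; apply: eq_sum_bool => c'; rewrite mulr_sum_boolr; apply: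
    eq_sum_bool => b'.
rewrite mulrCA; congr (_ * _); first by congr ice_weight; ring.
transitivity (chain (q ^+ 2 * u^-1) vs (fun t d =>
    right_half p ((l ++ [:: v]) ++ vs ++ [:: u]) ((pre ++ [:: b']) ++ t ++ [:: d])) c' s).
  by apply: eq_chain => t d _; rewrite -!catA.
by rewrite IH -?catA // !size_cat spre.
Qed.

(* The label of the top vertex of the central column is [q^2], where one of the three
   vertex weights vanishes and the other two are 1. *)
Lemma Z_end_reduction p vs u e : u != 0 -> p != 0 -> 0 \notin vs ->
  Z_end p (q ^+ 2 * u^-1) (vs ++ [:: u]) e =
  \prod_(v <- vs) (a_weight (q ^+ 2 * v * u^-1) * a_weight (v * u))
   * (sigma (q ^+ 2 * u ^+ 2) / sigma (q ^+ 2))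
   * sum_bool (fun c => right_weight p q u c (~~ e) * Z_end p u vs c).
Proof.
move=> u0 p0 vs0; rewrite /Z_end size_cat sum_states_cat.
under [X in _ = _ * X]eq_sum_bool => c do rewrite -sum_statesZ.
rewrite -sum_states_bool.
transitivity (sum_states (size vs) (fun s =>
   chain (q ^+ 2 * u^-1) vs (fun t c' => right_half p (vs ++ [:: u]) (t ++ [:: c'])) e s *
   right_half p^-1 (map GRing.inv (vs ++ [:: u])) (map negb (s ++ [:: true])))).
  (* With the outermost row in state [true], the top vertex has weight 1 and passes the state of the
     vertical line to the row on its right; state [false] forces the vanishing weight
     [sigma (q ^+ 2 / q ^+ 2)]. *)
  apply: eq_sum_states => s ss /=; rewrite /sum_bool -[RHS]addr0; congr (_ + _).
    congr (_ * _); rewrite /column chain_rcons //; apply: eq_chain => t d _.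
    rewrite -mulrA mulVf // mulr1 /ice_weight /bulk_weight /sum_bool.
    have E : sigma (q ^+ 2 * q ^+ 2) = sigma (q ^+ 4) by congr sigma; ring.
    have E' : sigma (q ^+ 2 / q ^+ 2) = 0.
      by rewrite divff ?expf_neq0 // /sigma invr1 subrr.
    rewrite E E' divff //; case: d => /=; ring.
  (* The zero is written as a product so that [chainZ] can extract it. *)
  rewrite /column chain_rcons // (@eq_chain _ _ _ (fun _ _ => 0 * 0)).
    by rewrite chainZ !mul0r.
  move=> t d _; rewrite -mulrA mulVf // mulr1 /ice_weight /bulk_weight /sum_bool.
  have E' : sigma (q ^+ 2 / q ^+ 2) = 0.
    by rewrite divff ?expf_neq0 // /sigma invr1 subrr.
  rewrite E'; case: d => /=; ring.
rewrite -sum_statesZ; apply: eq_sum_states => s ss.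
rewrite (@right_half_move p [::] vs u [::] e s u0 p0 vs0 erefl ss).
rewrite !map_cat right_half_frozen ?size_map // invrK big_map.
rewrite [right_half p _ _]/= [in RHS]big_split /=.
under [X in X * (_ / _)]eq_bigr => v _ do rewrite invfM !invrK.
rewrite /sum_bool; ring.
Qed.

(** Transposition of the transfer matrix: read from right to left, a column is the column of the
    mirror image. *)
Lemma column_adjoint x us f g c :
  sum_states (size us) (fun s => column x us f c s * g s) =
  sum_states (size us) (fun t => column x^-1 (map GRing.inv us)
     (fun s => g (map negb s)) c (map negb t) * f t).
Proof.
elim: us f g c => [|u us IH] f g c.
  by rewrite /column /=; case: c => //=; rewrite ?mul0r // mulrC.
have E b : sum_states (size us) (fun s => column x (u :: us) f c (b :: s) * g (b :: s)) =
  sum_bool (fun c' => sum_bool (fun b' => ice_weight (x * u) c b c' b' *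
    sum_states (size us) (fun t => column x^-1 (map GRing.inv us)
     (fun s => g (b :: map negb s)) c' (map negb t) * f (b' :: t)))).
  under [RHS]eq_sum_bool => c' do under eq_sum_bool => b' do
    rewrite -(IH (fun t => f (b' :: t)) (fun s => g (b :: s))) -sum_statesZ.
  under [RHS]eq_sum_bool => c' do rewrite -sum_states_bool.
  rewrite -sum_states_bool; apply: eq_sum_states => s _.
  rewrite [column _ _ _ _ _]/= /column /= /sum_bool; ring.
have E' b' : sum_states (size us) (fun t => column x^-1 (map GRing.inv (u :: us))
     (fun s => g (map negb s)) c (map negb (b' :: t)) * f (b' :: t)) =
  sum_bool (fun c' => sum_bool (fun b => ice_weight (x * u) c b c' b' *
    sum_states (size us) (fun t => column x^-1 (map GRing.inv us)
     (fun s => g (b :: map negb s)) c' (map negb t) * f (b' :: t)))).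
  under [RHS]eq_sum_bool => c' do under eq_sum_bool => b do rewrite ice_weight_mirror invfM
      -sum_statesZ.
  under [RHS]eq_sum_bool => c' do rewrite -sum_states_bool.
  rewrite -sum_states_bool; apply: eq_sum_states => s _.
  rewrite [column _ _ _ _ _]/= /column /= /sum_bool /=; ring.
rewrite /= /sum_bool -![sum_states _ _]/(sum_states _ (fun s => _)).
rewrite !E !E' /sum_bool; ring.
Qed.

Lemma Z_end_mirror p x us e : Z_end p x us e = Z_end p^-1 x^-1 (map GRing.inv us) e.
Proof.
rewrite /Z_end column_adjoint size_map -sum_states_negb; apply: eq_sum_states => s _.
have nn t : map negb (map negb t) = t by rewrite -map_comp map_id_in //= => b; rewrite /= negbK.
rewrite nn invrK -map_comp [map (_ \o _) _](_ : _ = us); last first.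
  by rewrite map_id_in // => v /=; rewrite invrK.
congr (_ * _).
by apply: eq_column => t _; rewrite nn.
Qed.

End SixVertex.

(** * Laurent polynomials of definite parity *)

Section LaurentParity.
Variables (F : fieldType).

(* For [x != 0], [h x] is a Laurent polynomial in [x] with exponents between [-n] and
   [n], all of the parity of [n] if [e] holds and of [n - 1] otherwise. *)
Definition laurent (n : nat) (e : bool) (h : F -> F) : Prop :=
  exists2 P : {poly F}, (size P <= n + e)%N
    & forall x, x != 0 -> x ^+ n * h x = x ^+ (~~ e) * P.[x ^+ 2].

Lemma eq_laurent n e h h' : (forall x, x != 0 -> h x = h' x) ->
  laurent n e h -> laurent n e h'.
Proof. by move=> eh [P sP hP]; exists P => // x x0; rewrite -eh ?hP. Qed.

Lemma laurent0 n e : laurent n e (fun _ => 0).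
Proof. by exists 0 => [|x _]; rewrite ?size_poly0 // horner0 !mulr0. Qed.

Lemma laurentD n e h h' : laurent n e h -> laurent n e h' ->
  laurent n e (fun x => h x + h' x).
Proof.
move=> [P sP hP] [Q sQ hQ]; exists (P + Q) => [|x x0].
  by rewrite (leq_trans (size_polyD _ _)) // geq_max sP.
by rewrite hornerD !mulrDr hP ?hQ.
Qed.

Lemma laurentZ n e k h : laurent n e h -> laurent n e (fun x => k * h x).
Proof.
move=> [P sP hP]; exists (k *: P) => [|x x0].
  by rewrite (leq_trans (size_scale_leq _ _)).
by rewrite hornerZ mulrCA hP // mulrCA.
Qed.

(** If both parities were opposite to those of [m] and [n], the product would have the parity of
    [m + n] again, which [d && e] does not express. *)
Lemma laurentM m n d e h h' : (d || e) -> laurent m d h -> laurent n e h' ->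
  laurent (m + n) (d && e) (fun x => h x * h' x).
Proof.
move=> de [P sP hP] [Q sQ hQ]; exists (P * Q) => [|x x0].
  have [->|P0] := eqVneq P 0; first by rewrite mul0r size_poly0.
  have [->|Q0] := eqVneq Q 0; first by rewrite mulr0 size_poly0.
  rewrite size_mul //; move: sP sQ; rewrite -!size_poly_gt0 in P0 Q0.
  move=> {hP hQ}; case: d e de => [] [] //= _; rewrite ?addn0 ?addn1 => sP sQ.
  - by rewrite -ltnS prednK ?addn_gt0 ?P0 // (leq_trans (leq_add sP sQ)) // addSn addnS.
  - by rewrite -ltnS prednK ?addn_gt0 ?P0 // (leq_trans (leq_add sP sQ)).
  - by rewrite -ltnS prednK ?addn_gt0 ?P0 // (leq_trans (leq_add sP sQ)) // addnS.
rewrite exprD mulrACA hP // hQ // hornerM.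
by case: d e de {sP sQ hP hQ} => [] [] //= _; ring.
Qed.

Lemma laurent_sigma (a : F) : laurent 1 true (fun x => sigma (a * x)).
Proof.
exists (a *: 'X - (a^-1)%:P) => [|x x0]; last first.
  by rewrite !hornerE /= /sigma invfM mulrBr (mulrCA x a^-1) mulfV // expr1; ring.
rewrite (leq_trans (size_polyD _ _)) // geq_max (leq_trans (size_scale_leq _ _)) ?size_polyX //.
by rewrite size_polyN (leq_trans (size_polyC_leq1 _)).
Qed.

Lemma laurent_sigmaV (a : F) : laurent 1 true (fun x => sigma (a * x^-1)).
Proof.
apply: (@eq_laurent _ _ (fun x => -1 * sigma (a^-1 * x))); last exact/laurentZ/laurent_sigma.
by move=> x x0; rewrite /sigma !invfM !invrK; ring.
Qed.

Lemma laurent_prod (I : Type) (r : seq I) (h : I -> F -> F) n :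
  (forall i, laurent n true (h i)) ->
  laurent (n * size r) true (fun x => \prod_(i <- r) h i x).
Proof.
move=> H; elim: r => [|i r IH].
  rewrite muln0; exists 1 => [|x _]; first by rewrite size_poly1.
  by rewrite big_nil hornerC.
rewrite mulnS; apply: (@eq_laurent _ _ (fun x => h i x * \prod_(i <- r) h i x)).
  by move=> x _; rewrite big_cons.
exact: (laurentM (d := true) (e := true)).
Qed.

Lemma laurent_succ n e h : laurent n e h -> laurent n.+1 (~~ e) h.
Proof.
move=> [P sP hP]; case: e sP hP => /= sP hP.
  exists P => [|x x0]; first by rewrite addn0 -addn1.
  by rewrite exprS -mulrA hP //= expr0 mul1r.
exists ('X * P) => [|x x0].
  have [->|P0] := eqVneq P 0; first by rewrite mulr0 size_poly0.
  by rewrite mulrC size_mulX // addn1 ltnS -(addn0 n) (leq_trans sP).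
by rewrite exprS -mulrA hP // !hornerE /=; ring.
Qed.

Variable (q : F).

Lemma laurent_ice_weight v c b b' : laurent 1 true (fun x => ice_weight q (x * v) c b c b').
Proof.
have A : laurent 1 true (fun x => sigma (q ^+ 2 * (x * v)) / sigma (q ^+ 4)).
  apply: (@eq_laurent _ _ (fun x => (sigma (q ^+ 4))^-1 * sigma (q ^+ 2 * v * x))).
    by move=> x _; rewrite mulrC -mulrA (mulrC v).
  exact/laurentZ/laurent_sigma.
have B : laurent 1 true (fun x => sigma (q ^+ 2 * (x * v)^-1) / sigma (q ^+ 4)).
  apply: (@eq_laurent _ _ (fun x => (sigma (q ^+ 4))^-1 * sigma (q ^+ 2 * v^-1 * x^-1))).
    by move=> x _; rewrite mulrC invfM (mulrC x^-1) mulrA.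
  exact/laurentZ/laurent_sigmaV.
by case: c b b' => [] [] [] //; exact: laurent0.
Qed.

(** A vertex that the vertical line passes without change of state has degree 1 in [x]; one where
    the state changes does not involve [x]. As the top edge points up, the bottom edge [c] fixes the
    parity of the number of changes. *)
Lemma laurent_column us f c s : size s = size us ->
  laurent (size us) c (fun x => column q x us f c s).
Proof.
elim: us f c s => [|v us IH] f c [|b s] //= => [_|[ss]].
  rewrite /column /=; case: c; last exact: laurent0.
  by exists (f [::])%:P => [|x _]; rewrite ?size_polyC_leq1 // hornerC.
suff H c' b' : laurent (size us).+1 c (fun x =>
    ice_weight q (x * v) c b c' b' * column q x us (fun t => f (b' :: t)) c' s).
  by apply: laurentD; apply: laurentD.
have {}IH := IH (fun t => f (b' :: t)) c' s ss.
case: (eqVneq c c') => [->|cc'].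
  by have := laurentM (d := true) isT (laurent_ice_weight v c' b b') IH.
have -> : c = ~~ c' by case: c c' cc' {IH} => [] [].
apply: laurent_succ.
(* The state changes here, so the weight does not depend on the label, which is replaced by 0. *)
apply: (@eq_laurent _ _ (fun x => ice_weight q 0 (~~ c') b c' b' *
    column q x us (fun t => f (b' :: t)) c' s)); last exact: laurentZ.
by move=> x _; case: c' b b' {IH cc'} => [] [] [].
Qed.

Lemma laurent_Z_end p us e : laurent (size us) e (fun x => Z_end q p x us e).
Proof.
have H n (h : seq bool -> F -> F) : (forall s, size s = n -> laurent (size us) e (h s)) ->
    laurent (size us) e (fun x => sum_states n (fun s => h s x)).
  elim: n h => [|n IH] h hh /=; first exact: hh.
  by apply: laurentD; apply: IH => s ss; apply: hh; rewrite /= ss.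
apply: H => s ss.
apply: (eq_laurent (h := fun x => right_half q p^-1 (map GRing.inv us) (map negb s) *
  column q x us (right_half q p us) e s)); first by move=> x _; rewrite mulrC.
exact/laurentZ/laurent_column.
Qed.
End LaurentParity.

Section Sigma.
Variable F : fieldType.
Implicit Types x y : F.

Lemma sigmaV x : sigma x^-1 = - sigma x.
Proof. by rewrite /sigma invrK opprB. Qed.

Lemma sigma1 : sigma (1 : F) = 0.
Proof. by rewrite /sigma invr1 subrr. Qed.

Lemma sigma_eq0 x : x != 0 -> (sigma x == 0) = (x ^+ 2 == 1).
Proof.
move=> x0; rewrite /sigma subr_eq0 expr2 -(inj_eq (mulfI x0)).
by rewrite mulfV.
Qed.
End Sigma.

(** * The determinant *)

Section Det.
Variables (F : fieldType) (q : F).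

Definition sigma_pair (a b : F) := sigma (q ^+ 2 * a * b) * sigma (q ^+ 2 * a^-1 * b^-1).

Lemma sigma_pairC a b : sigma_pair a b = sigma_pair b a.
Proof. by rewrite /sigma_pair -!mulrA (mulrC a) (mulrC a^-1). Qed.

Lemma sigma_pairV a b : sigma_pair a^-1 b^-1 = sigma_pair a b.
Proof. by rewrite /sigma_pair !invrK mulrC. Qed.

(* [ws] is [x :: us]; index 0 stands for the index [n + 1] of the theorem, so that
   deleting row 1 and column 0 gives the same matrix for [us]. *)
Definition AST_mx n (ws : seq F) (phi : F -> F) : 'M[F]_n.+1 :=
  \matrix_(i, j) if i == ord0 then phi ws`_j else (sigma_pair ws`_i ws`_j)^-1.

(* Column 0 is multiplied by the product of the [sigma_pair ws`_l x] for [l != 0],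
   which keeps it meaningful where one of these factors vanishes ([0^-1 = 0]). *)
Definition cleared_mx n (ws : seq F) (phi : F -> F) (x : F) : 'M[F]_n.+1 :=
  \matrix_(i, j) if j == ord0
    then (if i == ord0 then phi x else 1)
         * \prod_(l < n.+1 | (l != ord0) && (l != i)) sigma_pair ws`_l x
    else AST_mx n ws phi i j.

Lemma det_cleared_mx n ws phi x : \det (cleared_mx n ws phi x) =
  \sum_i cleared_mx n ws phi x i ord0 * cofactor (AST_mx n ws phi) i ord0.
Proof.
rewrite (expand_det_col _ ord0); apply: eq_bigr => i _; congr (_ * (_ * \det _)).
by apply/matrixP => k l; rewrite !mxE.
Qed.

Lemma det_cleared_mxE n ws phi : (forall l : 'I_n.+1, l != ord0 -> sigma_pair ws`_l ws`_0
    != 0) ->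
  \det (cleared_mx n ws phi ws`_0) =
  (\prod_(l < n.+1 | l != ord0) sigma_pair ws`_l ws`_0) * \det (AST_mx n ws phi).
Proof.
move=> s0; rewrite det_cleared_mx (expand_det_col _ ord0) mulr_sumr.
apply: eq_bigr => i _; rewrite [RHS]mulrA; congr (_ * _); rewrite !mxE /=.
case: eqVneq => [->|i0]; rewrite ?mul1r.
  by rewrite mulrC; congr (_ * _); apply: eq_bigl => l; rewrite andbb.
by rewrite [in RHS](bigD1 i) //= mulrAC mulfV ?mul1r // s0.
Qed.

(** Columns 0 and [k] of [AST_mx] coincide. *)
Lemma det_cleared_mx_eq0 n ws phi (k : 'I_n.+1) : k != ord0 -> ws`_k = ws`_0 ->
  (forall l : 'I_n.+1, l != ord0 -> sigma_pair ws`_l ws`_0 != 0) ->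
  \det (cleared_mx n ws phi ws`_0) = 0.
Proof.
move=> k0 wk s0; rewrite det_cleared_mxE //.
rewrite -det_tr (determinant_alternate (i1 := ord0) (i2 := k)) ?mulr0 //.
  by rewrite eq_sym.
by move=> i; rewrite !mxE /= wk.
Qed.

(** Every entry of column 0 outside the row of [u] contains the vanishing factor. Deleting that row
    and column 0 leaves the matrix in which [u] has taken the place of [x]. *)
Lemma det_cleared_mx_root n w u vs phi x : sigma_pair u x = 0 ->
  \det (cleared_mx n.+1 (w :: u :: vs) phi x) =
  - (\prod_(l < n.+1 | l != ord0) sigma_pair (u :: vs)`_l x) * \det (AST_mx n (u :: vs) phi).
Proof.
move=> ux; rewrite det_cleared_mx (bigD1 (lift ord0 ord0)) //= big1 ?addr0 => [|i i1].
  rewrite !mxE /= mul1r mulNr -mulrN; congr (_ * _).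
    rewrite big_mkcond [RHS]big_mkcond big_ord_recl /= mul1r.
    by apply: eq_bigr => i _; rewrite -(inj_eq (@lift_inj _ ord0)).
  rewrite /cofactor /= addn0 expr1 mulN1r; congr (- \det _).
  apply/matrixP => i j; rewrite !mxE /=.
  have [->|i0] := eqVneq i ord0; first by [].
  case: i i0 => [[|i] hi] //= _.
rewrite !mxE /= (bigD1 (lift ord0 ord0)) /=; last by rewrite eq_sym i1.
by rewrite ux mul0r mulr0 mul0r.
Qed.

(** The transposition acts on rows and columns at once, so its sign cancels. *)
Lemma det_cleared_mx_swap n x l a b r phi y : size (l ++ [:: a, b & r]) = n ->
  \det (cleared_mx n (x :: l ++ a :: b :: r) phi y) =
  \det (cleared_mx n (x :: l ++ b :: a :: r) phi y).
Proof.
move=> sn.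
have k1 : ((size l).+1 < n.+1)%N by rewrite -sn size_cat /=; lia.
have k2 : ((size l).+2 < n.+1)%N by rewrite -sn size_cat /=; lia.
pose s := tperm (Ordinal k1) (Ordinal k2).
have s0 (i : 'I_n.+1) : (s i == ord0) = (i == ord0).
  have e0 : s ord0 = ord0 by rewrite tpermD.
  by rewrite -{1}e0 (inj_eq perm_inj).
have sE (i : 'I_n.+1) : (x :: l ++ [:: b, a & r])`_i = (x :: l ++ [:: a, b & r])`_(s i).
  rewrite /s; case: tpermP => [->|->|/eqP h1 /eqP h2] /=.
  - by rewrite !nth_cat ltnn subnn ltnNge leqnSn /= subSnn.
  - by rewrite !nth_cat ltnn subnn ltnNge leqnSn /= subSnn.
  case: i h1 h2 => [[|i] hi] //=; rewrite -!val_eqE /= !eqSS !nth_cat.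
  case: ltnP => // li h1 h2.
  have -> : (i - size l = (i - size l).-2.+2)%N by lia.
  by [].
have -> : cleared_mx n (x :: l ++ b :: a :: r) phi y =
    row_perm s (col_perm s (cleared_mx n (x :: l ++ a :: b :: r) phi y)).
  apply/matrixP => i j; rewrite !mxE !s0 -!sE.
  case: ifP => // _; congr (_ * _).
  rewrite [RHS](reindex_inj (@perm_inj _ s)); apply: eq_big => k.
    by rewrite s0 (inj_eq perm_inj).
  by rewrite sE.
rewrite row_permE col_permE !det_mulmx !det_perm.
by rewrite odd_permV mulrCA -expr2 sqrr_sign mulr1.
Qed.

Lemma det_AST_mx_lin n ws a1 a2 f f1 f2 :
  (forall j : 'I_n.+1, f ws`_j = a1 * f1 ws`_j + a2 * f2 ws`_j) ->
  \det (AST_mx n ws f) = a1 * \det (AST_mx n ws f1) + a2 * \det (AST_mx n ws f2).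
Proof.
move=> H; rewrite !(expand_det_row _ ord0) !mulr_sumr -big_split /=.
have E g j : cofactor (AST_mx n ws g) ord0 j = cofactor (AST_mx n ws f) ord0 j.
  by congr (_ * \det _); apply/matrixP => k l; rewrite !mxE.
apply: eq_bigr => j _; rewrite !(E f1, E f2) ![AST_mx _ _ _ _ _]mxE /= H; ring.
Qed.

End Det.

(** * Degree of the determinant in the central parameter *)

Section LaurentDet.
Variables (F : fieldType) (q : F).

(** The underlying polynomial is evaluated at [x ^+ 2], so the nodes must have distinct squares. *)
Lemma laurent_eq0 n e (h : F -> F) (s : seq F) : laurent n e h ->
  (forall x, x \in s -> x != 0 /\ h x = 0) ->
  uniq [seq x ^+ 2 | x <- s] -> (n + e <= size s)%N ->
  forall x, x != 0 -> h x = 0.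
Proof.
move=> [P sP hP] hs us ns x x0; apply: (mulfI (expf_neq0 n x0)).
rewrite mulr0 hP // [P](_ : _ = 0) ?horner0 ?mulr0 //.
apply: (roots_geq_poly_eq0 _ us); last by rewrite size_map (leq_trans sP).
apply/allP => y /mapP[z zs ->]; have [z0 hz] := hs z zs.
apply/eqP; apply: (mulfI (expf_neq0 (~~ e) z0)).
by rewrite -hP // hz !mulr0.
Qed.

Lemma laurent_sum n e (I : Type) (r : seq I) (h : I -> F -> F) :
  (forall i, laurent n e (h i)) -> laurent n e (fun x => \sum_(i <- r) h i x).
Proof.
move=> H; elim: r => [|i r IH].
  by apply: eq_laurent (laurent0 _ _ _) => x _; rewrite big_nil.
by apply: eq_laurent (laurentD (H i) IH) => x _; rewrite big_cons.
Qed.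

Lemma laurentZr n e k (h : F -> F) : laurent n e h -> laurent n e (fun x => h x * k).
Proof. by move=> /(laurentZ k); apply: eq_laurent => x _; rewrite mulrC. Qed.

Lemma laurent_sigma_pair a : laurent 2 true (sigma_pair q a).
Proof.
apply: (@laurentM _ 1 1 true true) => //; first exact: laurent_sigma.
exact: laurent_sigmaV.
Qed.

(* The two parities in [x] of the last row of the matrix of the theorem. *)
Definition last_row p e (x t : F) : F :=
  if e then 1 else - (sigma (x^-1 * t) / sigma (p^-1 * t)).

Lemma laurent_last_row p t : laurent 1 true (fun x => last_row p false x t).
Proof.
apply: (@eq_laurent _ _ _ (fun x => - (sigma (p^-1 * t))^-1 * sigma (t * x^-1))).
  by move=> x _; rewrite /last_row mulNr mulrC (mulrC t).
exact/laurentZ/laurent_sigmaV.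
Qed.

Lemma laurent_prod_sigma_pair n (ws : nat -> F) (A : pred 'I_n) k : #|A| = k ->
  laurent (2 * k) true (fun x => \prod_(l | A l) sigma_pair q (ws l) x).
Proof.
rewrite cardE => <-.
apply: (@eq_laurent _ _ _ (fun x => \prod_(l <- enum A) sigma_pair q (ws l) x)).
  by move=> x _; rewrite big_enum.
by apply: laurent_prod => i; exact: laurent_sigma_pair.
Qed.

(** Since [i != ord0], the minor keeps row 0, the only row involving [x], and is linear in it. The
    entry [0] holds the place of [x], which the minors of column 0 never read. *)
Lemma laurent_cofactor n p us (i : 'I_n.+1) : i != ord0 ->
  laurent 1 true (fun x => cofactor (AST_mx q n (0 :: us) (last_row p false x)) i ord0).
Proof.
case: n i => [|n] i i0; first by rewrite ord1 eqxx in i0.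
pose f x (j : 'I_n.+1) := last_row p false x (us`_(nat_of_ord j)).
pose c (j : 'I_n.+1) := cofactor (row' i (col' ord0 (AST_mx q n.+1 (0 :: us) (fun=> 0))))
    ord0 j.
refine (@eq_laurent _ _ _ (fun x => (-1) ^+ (i + 0) * \sum_(j < n.+1) f x j * c j) _ _ _).
  move=> x _; rewrite /cofactor (expand_det_row _ ord0); congr (_ * _).
  have l0 : lift i ord0 = ord0.
    by apply: val_inj; rewrite /= /bump leqn0; move: i0; rewrite -val_eqE /= => /negbTE ->.
  apply: eq_bigr => j _; congr (_ * _); first by rewrite !mxE l0.
  congr (_ * \det _); apply/matrixP => k m; rewrite !mxE.
  by rewrite -{1 3}l0 (inj_eq lift_inj).
apply/laurentZ/laurent_sum => j; apply/laurentZr/laurent_last_row.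
Qed.

(** Expansion along column 0: the top term has [size us] factors of degree 2, and for [e = false] it
    is 0 because [sigma 1 = 0]; the others have one factor less and, for [e = false], a cofactor of
    degree 1. [laurent_succ] adjusts the bounds. *)
Lemma laurent_det p us e :
  laurent (2 * size us) e (fun x => \det (cleared_mx q (size us) (x :: us) (last_row p e x) x)).
Proof.
set n := size us.
pose A (i : 'I_n.+1) := [pred l : 'I_n.+1 | (l != ord0) && (l != i)].
have cA (i : 'I_n.+1) : i != ord0 -> #|A i| = n.-1.
  move=> i0; have c1 : #|predC1 (ord0 : 'I_n.+1)| = n by rewrite cardC1 card_ord.
  apply: etrans (congr1 predn c1); rewrite [in RHS](cardD1 i) inE i0 add1n /=.
  by apply: eq_card => l; rewrite !inE andbC.
have pE (i : 'I_n.+1) x :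
  \prod_(l < n.+1 | (l != ord0) && (l != i)) sigma_pair q (x :: us)`_l x =
  \prod_(l | A i l) sigma_pair q (0 :: us)`_l x.
  by apply: eq_bigr => -[[|l] hl] //.
have cE f (i : 'I_n.+1) x : cofactor (AST_mx q n (x :: us) f) i ord0 = cofactor (AST_mx q n
    (0 :: us) f) i ord0.
  congr (_ * \det _); apply/matrixP => k m; rewrite !mxE lift0 /=.
  by have [//|] := eqVneq (lift i k) ord0; rewrite -val_eqE /=; case: (bump i k).
pose T (i : 'I_n.+1) x := (if i == ord0 then last_row p e x x else 1) *
  \prod_(l | A i l) sigma_pair q (0 :: us)`_l x * cofactor (AST_mx q n (0 :: us) (last_row
      p e x)) i ord0.
apply: (@eq_laurent _ _ _ (fun x => \sum_i T i x)).
  move=> x _; rewrite det_cleared_mx; apply: eq_bigr => i _.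
  by rewrite cE !mxE /= pE.
apply: laurent_sum => i; rewrite /T; have [->|i0] := eqVneq i ord0; last first.
  have n0 : n != 0%N by case: (n) i i0 {T A cA pE cE} => // i; rewrite ord1 eqxx.
  have -> : (2 * n = (2 * n.-1).+2)%N by lia.
  have P := laurent_prod_sigma_pair (fun l => (0 :: us)`_l) (cA i i0).
  case: e {T}.
    rewrite -[true]/(~~ ~~ true); do 2!apply: laurent_succ.
    apply: eq_laurent (laurentZr (cofactor (AST_mx q n (0 :: us) (fun=> 1)) i ord0) P).
    by move=> x _; rewrite mul1r.
  rewrite -[false]/(~~ true); apply: laurent_succ; rewrite -addn1.
  apply: (laurentM (d := true) (e := true)) => //; last exact: laurent_cofactor.
  by apply: eq_laurent P => x _; rewrite mul1r.
case: e {T}; last first.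
  apply: eq_laurent (laurent0 _ _ _) => x x0.
  by rewrite /last_row mulVf // sigma1 mul0r oppr0 !mul0r.
have c0 : #|A ord0| = n; last first.
  have P := laurent_prod_sigma_pair (fun l => (0 :: us)`_l) c0.
  apply: eq_laurent (laurentZr (cofactor (AST_mx q n (0 :: us) (fun=> 1)) ord0 ord0) P).
  by move=> x _; rewrite mul1r.
have c1 : #|predC1 (ord0 : 'I_n.+1)| = n by rewrite cardC1 card_ord.
apply: etrans c1; by apply: eq_card => l; rewrite !inE andbb.
Qed.

End LaurentDet.

(** * Interpolation *)

Section Identity.
Variables (F : fieldType) (q : F).
Hypotheses (q0 : q != 0) (sq4 : sigma (q ^+ 4) != 0).

(** Besides keeping denominators away from 0, the conditions on [sigma_pair] and
    [sigma (q ^+ 4 * u * v^-1)] separate the interpolation nodes, and the latter makes the scalar of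
    the exchange relation invertible. The class is closed under permutation, deletion and inversion,
    as the induction requires. *)
Definition generic (p : F) (us : seq F) : Prop :=
  [/\ p != 0 /\ 0 \notin us,
      {in us, forall u, sigma (p^-1 * u) != 0},
      {in us &, forall u v, sigma_pair q u v != 0},
      {in us &, forall u v, sigma (q ^+ 4 * u * v^-1) != 0}
    & uniq [seq u ^+ 2 | u <- us]].

Lemma generic_perm p us vs : perm_eq us vs -> generic p us -> generic p vs.
Proof.
move=> e [[p0 us0] s1 s2 s3 un]; have m := perm_mem e.
split.
- by rewrite -m.
- by move=> u; rewrite -m; exact: s1.
- by move=> u v; rewrite -!m; exact: s2.
- by move=> u v; rewrite -!m; exact: s3.
- by rewrite -(perm_uniq (perm_map _ e)).
Qed.

Lemma generic_behead p u us : generic p (u :: us) -> generic p us.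
Proof.
move=> [[p0 us0] s1 s2 s3 un]; have m v : v \in us -> v \in u :: us.
  by rewrite inE orbC => ->.
split.
- by move: us0; rewrite inE negb_or => /andP[].
- by move=> v /m; exact: s1.
- by move=> v w /m vu /m; exact: s2.
- by move=> v w /m vu /m; exact: s3.
- by move: un => /= /andP[].
Qed.

Lemma generic_inv p us : generic p us -> generic p^-1 (map GRing.inv us).
Proof.
move=> [[p0 us0] s1 s2 s3 un]; split.
- split; first by rewrite invr_eq0.
  by apply: contra us0; rewrite -{1}invr0 (mem_map (@invr_inj F)).
- move=> _ /mapP[u uu ->]; rewrite invrK.
  by rewrite -[p * _](invrK) sigmaV oppr_eq0 invfM invrK s1.
- by move=> _ _ /mapP[u uu ->] /mapP[v vv ->]; rewrite sigma_pairV s2.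
- move=> _ _ /mapP[u uu ->] /mapP[v vv ->]; rewrite invrK.
  by rewrite -mulrA (mulrC u^-1) mulrA s3.
- rewrite -map_comp (eq_map (g := GRing.inv \o (fun u => u ^+ 2))).
    by rewrite map_comp map_inj_uniq //; exact: invr_inj.
  by move=> u /=; rewrite exprVn.
Qed.

Fixpoint disc (us : seq F) : F :=
  if us is u :: vs then (\prod_(v <- vs) sigma (u * v^-1) ^+ 2) * disc vs else 1.

Definition Z_side p us e x : F :=
  Z_end q p x us e
  * (sigma (q ^+ 2) ^+ (2 * size us) * sigma (q ^+ 4) ^+ (size us * (size us).-1))
  * disc us * \prod_(u <- us) sigma (u * x^-1).

(** The factors [sigma_pair q u x] of the numerator sit inside [cleared_mx], which stays meaningful
    at their zeros. *)
Definition det_side p us e x : F :=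
  (\prod_(u <- us) sigma (p^-1 * u)) * (\prod_(u <- us) \prod_(v <- us) sigma_pair q u v)
  * \det (cleared_mx q (size us) (x :: us) (last_row p e x) x).

Lemma disc_swap l a b r : disc (l ++ a :: b :: r) = disc (l ++ b :: a :: r).
Proof.
have sC : sigma (a * b^-1) ^+ 2 = sigma (b * a^-1) ^+ 2.
  by rewrite -[a * _]invrK sigmaV sqrrN invfM invrK mulrC.
elim: l => [|u l IH] /=; last first.
  rewrite IH; congr (_ * _); apply: perm_big.
  by rewrite perm_cat2l -![_ :: _ :: r]/([:: _; _] ++ r) perm_cat2r (perm_catC [:: a] [:: b]).
rewrite !big_cons sC; ring.
Qed.

Lemma perm_swap (T : eqType) (l : seq T) a b r : perm_eq (l ++ a :: b :: r) (l ++ b :: a :: r).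
Proof.
by rewrite perm_cat2l -![_ :: _ :: r]/([:: _; _] ++ r) perm_cat2r (perm_catC [:: a] [:: b]).
Qed.

Lemma Z_end_swap_generic p l a b r e x : x != 0 -> generic p (l ++ a :: b :: r) ->
  Z_end q p x (l ++ a :: b :: r) e = Z_end q p x (l ++ b :: a :: r) e.
Proof.
move=> x0 [[p0 us0] _ _ s3 _]; apply: Z_end_swap => //.
rewrite /a_weight mulf_neq0 ?invr_eq0 //.
have -> : q ^+ 2 * (q ^+ 2 * a * b^-1) = q ^+ 4 * a * b^-1 by ring.
by rewrite s3 // mem_cat !inE eqxx ?orbT.
Qed.

Lemma Z_side_swap p l a b r e x : x != 0 -> generic p (l ++ a :: b :: r) ->
  Z_side p (l ++ a :: b :: r) e x = Z_side p (l ++ b :: a :: r) e x.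
Proof.
move=> x0 g; rewrite /Z_side Z_end_swap_generic // disc_swap (perm_big _ (perm_swap l a b r)).
by rewrite !size_cat.
Qed.

Lemma det_side_swap p l a b r e x :
  det_side p (l ++ a :: b :: r) e x = det_side p (l ++ b :: a :: r) e x.
Proof.
have e' := perm_swap l a b r.
rewrite /det_side det_cleared_mx_swap // (perm_size e') !(perm_big _ e') /=; congr (_ * _ * _).
by apply: eq_bigr => u _; rewrite (perm_big _ e').
Qed.

Lemma swap_to_head p (f : seq F -> F) :
  (forall l a b r, generic p (l ++ a :: b :: r) ->
    f (l ++ a :: b :: r) = f (l ++ b :: a :: r)) ->
  forall l u r, generic p (l ++ u :: r) -> f (l ++ u :: r) = f (u :: l ++ r).
Proof.
move=> H; elim/last_ind => [|l a IH] u r //; rewrite -cats1 -!catA /= => g.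
by rewrite H // IH //; apply: generic_perm g; exact: perm_swap.
Qed.

Lemma prod_ord_seq (f : F -> F) u vs :
  \prod_(l < (size vs).+1 | l != ord0) f (u :: vs)`_l = \prod_(v <- vs) f v.
Proof.
by rewrite big_mkcond big_ord_recl /= mul1r (big_nth 0) big_mkord.
Qed.

Lemma prod_seq_const (T : Type) (vs : seq T) (c : F) : \prod_(v <- vs) c = c ^+ size vs.
Proof. by rewrite big_const_seq count_predT iter_mulr_1. Qed.

(** The boundary weights left by the reduction turn the two last rows at [x = u] into the one at
    [q ^+ 2 / u]. If the bottom edge points up, the zero weight of two incoming edges prevents
    mixing; otherwise this is the three-term relation [h] between products of sigmas. *)
Lemma last_row_relation p u vs e : u != 0 -> p != 0 -> 0 \notin vs ->
  {in u :: vs, forall t, sigma (p^-1 * t) != 0} ->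
  let D f := \det (AST_mx q (size vs) (u :: vs) f) in
  sigma (q ^+ 2) * sum_bool (fun c => right_weight p q u c (~~ e) * D (last_row p c u))
  = sigma (p^-1 * u) * D (last_row p e (q ^+ 2 * u^-1)).
Proof.
move=> u0 p0 vs0 s1 /=; have s2 := sigma_q2_neq0 q0 sq4.
have su : sigma (p^-1 * u) != 0 by rewrite s1 ?mem_head.
case: e => /=.
  rewrite /sum_bool /= mul0r addr0 mulrA [_ * (_ / _)]mulrCA mulfV ?mulr1 //.
rewrite (@det_AST_mx_lin _ _ _ _ (sigma (q ^+ 2 * u^-1 ^+ 2) / sigma (p^-1 * u))
  (sigma (p^-1 * q ^+ 2 * u^-1) / sigma (p^-1 * u)) _ (last_row p true u) (last_row p false u)).
  rewrite /sum_bool /=; move: su s2; set A := sigma (p^-1 * u); set B := sigma (q ^+ 2).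
  by move=> su s2; field; rewrite su s2.
move=> j; set t := (u :: vs)`_j.
have tin : t \in u :: vs by rewrite mem_nth.
have t0 : t != 0 by apply: contraNneq vs0 => h; move: tin; rewrite h inE eq_sym (negbTE u0).
have st := s1 t tin.
rewrite /last_row /=.
have h : sigma ((q ^+ 2 * u^-1)^-1 * t) * sigma (p^-1 * u) =
   - (sigma (q ^+ 2 * u^-1 ^+ 2) * sigma (p^-1 * t) -
     sigma (p^-1 * q ^+ 2 * u^-1) * sigma (u^-1 * t)).
  by rewrite /sigma; field; rewrite q0 u0 p0 t0.
have -> := canRL (mulfK su) h.
move: su st; set A := sigma (p^-1 * u); set B := sigma (p^-1 * t) => su st.
by field; rewrite su st.
Qed.

(** [Z_end_reduction] and [det_cleared_mx_root] split off matching scalars, and [last_row_relation]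
    matches what they leave. *)
Lemma Z_side_eq_root p u vs e : generic p (u :: vs) ->
  (forall c, Z_side p vs c u = det_side p vs c u) ->
  Z_side p (u :: vs) e (q ^+ 2 * u^-1) = det_side p (u :: vs) e (q ^+ 2 * u^-1).
Proof.
move=> g IH; have [[p0 us0] s1 s2 s3 _] := g.
move: (us0); rewrite inE negb_or eq_sym => /andP[u0 vs0].
have s20 := sigma_q2_neq0 q0 sq4.
set x := q ^+ 2 * u^-1; have x0 : x != 0 by rewrite mulf_neq0 ?invr_eq0 ?expf_neq0.
have ux : sigma_pair q u x = 0.
  rewrite /sigma_pair (_ : q ^+ 2 * u^-1 * x^-1 = 1) ?sigma1 ?mulr0 //.
  by rewrite /x -/x mulfV.
pose D f := \det (AST_mx q (size vs) (u :: vs) f).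
have IHD c : Z_side p vs c u = (\prod_(v <- vs) sigma (p^-1 * v)) *
   (\prod_(v <- vs) \prod_(w <- vs) sigma_pair q v w) *
   (\prod_(v <- vs) sigma_pair q v u * D (last_row p c u)).
  rewrite IH /det_side; congr (_ * _).
  rewrite -[in X in cleared_mx _ _ _ _ X](erefl : (u :: vs)`_0 = u) det_cleared_mxE; last first.
    move=> l l0; apply: s2; last exact: mem_head.
    exact: mem_nth.
  by rewrite (prod_ord_seq (fun v => sigma_pair q v u)).
(* For each [v] the two [a_weight]s give one sigma of [sigma_pair q v x] and one of
   [sigma_pair q v u]; at this [x] the factors [sigma (u / v)] and [sigma (v / x)] are, up to sign,
   the remaining ones. *)
have L : \prod_(v <- vs) (a_weight q (q ^+ 2 * v * u^-1) * a_weight q (v * u))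
    * \prod_(v <- vs) sigma (u * v^-1) ^+ 2
    * \prod_(v <- vs) sigma (v * x^-1) * (sigma (q ^+ 4) ^+ 2) ^+ size vs =
    \prod_(v <- vs) sigma (v * u^-1) * \prod_(v <- vs) sigma_pair q v u * \prod_(v <- vs)
        sigma_pair q v x.
  rewrite -prod_seq_const -!big_split /=; apply: eq_big_seq => v vin.
  have v0 : v != 0 by apply: contraNneq vs0 => <-.
  rewrite /a_weight /sigma_pair.
  have -> : sigma (u * v^-1) = - sigma (v * u^-1) by rewrite -sigmaV invfM invrK mulrC.
  have -> : sigma (v * x^-1) = - sigma (q ^+ 2 * v^-1 * u^-1).
    by rewrite -sigmaV; congr sigma; rewrite /x; field; rewrite q0 u0 v0.
  have -> : sigma (q ^+ 2 * v^-1 * x^-1) = - sigma (v * u^-1).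
    by rewrite -sigmaV; congr sigma; rewrite /x; field; rewrite q0 u0 v0.
  have -> : sigma (q ^+ 2 * v * x) = sigma (q ^+ 2 * (q ^+ 2 * v * u^-1)).
    by congr sigma; rewrite /x; ring.
  rewrite (mulrA _ v u); move: sq4; set S4 := sigma (q ^+ 4) => S40.
  field.
  done.
have K := @last_row_relation p u vs e u0 p0 vs0 s1.
have H0 : Z_end q p x (u :: vs) e = \prod_(v <- vs) (a_weight q (q ^+ 2 * v * u^-1) *
    a_weight q (v * u))
   * (sigma (q ^+ 2 * u ^+ 2) / sigma (q ^+ 2))
   * sum_bool (fun c => right_weight p q u c (~~ e) * Z_end q p u vs c).
  rewrite -Z_end_reduction //.
  rewrite (@swap_to_head p (fun us => Z_end q p x us e)) ?cats0 //.
    by move=> l a b r; exact: Z_end_swap_generic.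
  by apply: generic_perm g; rewrite -cat1s perm_catC.
have sux : sigma (u * x^-1) = - sigma (q ^+ 2 * u^-1 * u^-1).
  by rewrite -sigmaV; congr sigma; rewrite /x; field; rewrite q0 u0.
rewrite /Z_side H0 /= !big_cons sux.
(* The exponents for consecutive sizes differ by twice the smaller size, which cancels the
   denominators of the [a_weight]s. *)
have E4 : sigma (q ^+ 4) ^+ ((size vs).+1 * size vs) =
    (sigma (q ^+ 4) ^+ 2) ^+ size vs * sigma (q ^+ 4) ^+ (size vs * (size vs).-1).
  rewrite -exprM -exprD; congr (_ ^+ _).
  by case: (size vs) => // n; rewrite /= !mulSn !mulnS; lia.
rewrite E4 mulnS (exprD (sigma (q ^+ 2))).
set S2 := sigma (q ^+ 2) in s20 K *; set S4 := sigma (q ^+ 4) in L *.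
transitivity (- sigma (q ^+ 2 * u^-1 * u^-1) * sigma (q ^+ 2 * u ^+ 2) *
  \prod_(v <- vs) sigma_pair q v u * \prod_(v <- vs) sigma_pair q v x * S2 *
  sum_bool (fun c => right_weight p q u c (~~ e) * Z_side p vs c u)).
  transitivity ((\prod_(v <- vs) (a_weight q (q ^+ 2 * v * u^-1) * a_weight q (v * u))
    * \prod_(v <- vs) sigma (u * v^-1) ^+ 2
    * \prod_(v <- vs) sigma (v * x^-1) * (S4 ^+ 2) ^+ size vs)
    * (sigma (q ^+ 2 * u ^+ 2) * S2 * (- sigma (q ^+ 2 * u^-1 * u^-1))
    * sum_bool (fun c => right_weight p q u c (~~ e) * (Z_end q p u vs c *
       (S2 ^+ (2 * size vs) * S4 ^+ (size vs * (size vs).-1)) * disc vs)))).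
    rewrite /sum_bool; set N2 := S2 ^+ (2 * _); set N4 := S4 ^+ (_ * _); set N4' := _ ^+
        size vs.
    set Y := \prod_(v <- vs) _; set Y' := \prod_(v <- vs) _.
    by field.
  rewrite L /Z_side /sum_bool -/S2 -/S4; ring.
under eq_sum_bool => c do rewrite IHD.
transitivity (- sigma (q ^+ 2 * u^-1 * u^-1) * sigma (q ^+ 2 * u ^+ 2) *
  \prod_(v <- vs) sigma_pair q v u * \prod_(v <- vs) sigma_pair q v x *
  (\prod_(v <- vs) sigma (p^-1 * v) *
   (\prod_(v <- vs) \prod_(w <- vs) sigma_pair q v w) *
   \prod_(v <- vs) sigma_pair q v u) *
  (S2 * sum_bool (fun c => right_weight p q u c (~~ e) * D (last_row p c u)))).
  rewrite /sum_bool; ring.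
rewrite K /det_side /= !big_cons det_cleared_mx_root // (prod_ord_seq (fun v => sigma_pair
    q v x)).
under [X in _ = _ * (_ * X) * _]eq_bigr => v _ do rewrite big_cons.
have suu : sigma_pair q u u = sigma (q ^+ 2 * u ^+ 2) * sigma (q ^+ 2 * u^-1 * u^-1).
  by rewrite /sigma_pair -(mulrA _ u u).
have -> : \prod_(v <- vs) (sigma_pair q v u * \prod_(w <- vs) sigma_pair q v w) =
    \prod_(v <- vs) sigma_pair q v u * \prod_(v <- vs) \prod_(w <- vs) sigma_pair q v w.
  exact: big_split.
rewrite suu.
have -> : \prod_(v <- vs) sigma_pair q u v = \prod_(v <- vs) sigma_pair q v u.
  by apply: eq_bigr => v _; rewrite sigma_pairC.
rewrite -/(D _); ring.
Qed.

(** Inverting all parameters multiplies both sides by the same sign, through [sigma (u / x)] on the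
    left and [sigma (u / p)] on the right. *)
Lemma Z_side_eq_mirror p us x :
  Z_side p^-1 (map GRing.inv us) true x^-1 = det_side p^-1 (map GRing.inv us) true x^-1 ->
  Z_side p us true x = det_side p us true x.
Proof.
have N0 : \prod_(u <- us) (-1 : F) != 0.
  by rewrite prod_seq_const expf_neq0 // oppr_eq0 oner_eq0.
have dE vs : disc (map GRing.inv vs) = disc vs :> F.
  elim: vs => //= v vs ->; congr (_ * _); rewrite big_map; apply: eq_bigr => w _.
  by rewrite invrK -[in RHS]sqrrN -sigmaV invfM invrK.
have -> : Z_side p^-1 (map GRing.inv us) true x^-1 =
    \prod_(u <- us) (-1) * Z_side p us true x.
  rewrite /Z_side -Z_end_mirror size_map dE big_map [RHS]mulrCA; congr (_ * _).
  rewrite -big_split /=; apply: eq_bigr => u _.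
  by rewrite invrK mulN1r -sigmaV invfM invrK.
have -> : det_side p^-1 (map GRing.inv us) true x^-1 =
    \prod_(u <- us) (-1) * det_side p us true x.
  rewrite /det_side !big_map size_map !mulrA; congr (_ * _ * _).
  - rewrite -big_split /=; apply: eq_bigr => u _.
    by rewrite invrK mulN1r -sigmaV invfM invrK.
  - apply: eq_bigr => u _; rewrite big_map; apply: eq_bigr => v _.
    exact: sigma_pairV.
  congr (\det _); apply/matrixP => i j; rewrite !mxE -!map_cons.
  have nE (l : 'I_(size us).+1) : (map GRing.inv (x :: us))`_l = ((x :: us)`_l)^-1.
    by rewrite (nth_map 0) //=.
  rewrite !nE sigma_pairV; case: ifP => // _; congr (_ * _).
  by apply: eq_bigr => l _; rewrite !nE sigma_pairV.
by move/(mulfI N0).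
Qed.

Lemma laurent_sides p us e : laurent (2 * size us) e (fun x => Z_side p us e x - det_side p
    us e x).
Proof.
apply: (@eq_laurent _ _ _ (fun x => Z_side p us e x + -1 * det_side p us e x)).
  by move=> x _; rewrite mulN1r.
apply: laurentD; last first.
  by apply/laurentZ; rewrite /det_side; apply/laurentZ/laurent_det.
rewrite /Z_side mul2n -addnn -[e in laurent _ e]andbT.
apply: (laurentM (e := true)); first by rewrite orbT.
  by do 2!apply/laurentZr; exact: laurent_Z_end.
rewrite -{1}[size us]mul1n; apply: laurent_prod => u; exact: laurent_sigmaV.
Qed.

Lemma Z_side_eq p us : generic p us ->
  forall e x, x != 0 -> Z_side p us e x = det_side p us e x.
Proof.
move sus: (size us) => n; elim: n p us sus => [|n IH] p us.
  move/size0nil => -> _ e x x0; rewrite /Z_side /det_side /= !big_nil det_mx11 !mxE /=.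
  rewrite big_pred0 => [|l]; last by rewrite ord1.
  rewrite /Z_end /= /column /= /last_row !mulr1 !mul1r mulVf // sigma1 mul0r oppr0.
  by case: e.
move=> sus g e x x0; apply/eqP; rewrite -subr_eq0; apply/eqP; move: x x0.
(* Stated for arbitrary parameters so that it also covers the mirror image used for the extra
   node. *)
have R p' vs u e' : generic p' vs -> size vs = n.+1 -> u \in vs ->
    Z_side p' vs e' (q ^+ 2 * u^-1) = det_side p' vs e' (q ^+ 2 * u^-1).
  move=> g' sv uin; have [[p0 v0] _ _ _ _] := g'.
  have u0 : u != 0 by apply: contraNneq v0 => <-.
  have x0 : q ^+ 2 * u^-1 != 0 by rewrite mulf_neq0 ?invr_eq0 ?expf_neq0.
  have [l [r vE]] : exists l r, vs = l ++ u :: r.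
    by case/splitPr: uin => l r; exists l, r.
  rewrite vE in g' sv *.
  rewrite (@swap_to_head p' (fun us => Z_side p' us e' (q ^+ 2 * u^-1))) //; last first.
    by move=> *; exact: Z_side_swap.
  rewrite (@swap_to_head p' (fun us => det_side p' us e' (q ^+ 2 * u^-1))) //; last first.
    by move=> *; exact: det_side_swap.
  have g2 : generic p' (u :: l ++ r).
    by apply: generic_perm g'; rewrite -cat1s perm_catCA.
  apply: Z_side_eq_root => // c; apply: IH => //; last exact: generic_behead g2.
  by move: sv; rewrite !size_cat /= addnS => -[].
have [[p0 us0] s1 s2 s3 un] := g.
have nz u : u \in us -> u != 0 by move=> uin; apply: contraNneq us0 => <-.
have [u0 u0in] : exists u0, u0 \in us.
  by case: (us) sus => // u0 ? _; exists u0; rewrite mem_head.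
(* For [e = true] the difference has one coefficient more, hence the additional node. *)
pose roots := us ++ [seq q ^+ 2 * u^-1 | u <- us] ++ (if e then [:: q ^- 2 * u0^-1] else [::]).
apply: (laurent_eq0 (s := roots) (laurent_sides p us e)).
- move=> x; rewrite !mem_cat => /or3P[xin|/mapP[u uin ->]|].
  + split; first exact: nz.
    (* On the left a factor [sigma (u / x)] vanishes, on the right two columns agree. *)
    rewrite /Z_side /det_side (big_rem x xin) /= mulfV ?nz // sigma1 mul0r mulr0 sub0r.
    have [k kl xE] := (nthP 0 xin).
    have h := @det_cleared_mx_eq0 F q (size us) (x :: us) (last_row p e x) (Ordinal (kl :
        (k.+1 < (size us).+1)%N)).
    rewrite [X in _ * X](_ : _ = 0) ?mulr0 ?oppr0 //; apply: h => //.
    move=> [[|l] hl] //= _; apply: s2 => //; exact: mem_nth.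
  + split; first by rewrite mulf_neq0 ?invr_eq0 ?expf_neq0 ?(nz u).
    by rewrite R // subrr.
  case: (e) => //; rewrite inE => /eqP->.
  split; first by rewrite mulf_neq0 ?invr_eq0 ?expf_neq0 ?(nz u0).
  (* The inverse [q ^+ 2 * u0] is a node of the second kind for the inverted parameters. *)
  apply/eqP; rewrite subr_eq0; apply/eqP; apply: Z_side_eq_mirror.
  rewrite invfM invrK; apply: R; first exact: generic_inv.
    by rewrite size_map.
  exact: map_f.
- have ne (a b c : F) : a != 0 -> b != 0 -> sigma c != 0 -> c = a * b^-1 -> a ^+ 2 != b ^+ 2.
    move=> a0 b0 sc cE; apply: contra sc => /eqP h.
    by rewrite cE sigma_eq0 ?mulf_neq0 ?invr_eq0 // exprMn exprVn h mulfV ?expf_neq0.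
  have z0 u : u \in us -> q ^+ 2 * u^-1 != 0.
    by move=> uin; rewrite mulf_neq0 ?invr_eq0 ?expf_neq0 ?(nz u).
  have z0' : q ^- 2 * u0^-1 != 0.
    by rewrite mulf_neq0 ?invr_eq0 ?expf_neq0 ?(nz u0).
  have n1 u v : u \in us -> v \in us -> (q ^+ 2 * u^-1) ^+ 2 != v ^+ 2.
    move=> uin vin; have := s2 u v uin vin; rewrite mulf_eq0 negb_or => /andP[_ h].
    by apply: (ne _ _ _ _ _ h); rewrite ?z0 ?(nz v).
  have n2 v : v \in us -> (q ^- 2 * u0^-1) ^+ 2 != v ^+ 2.
    move=> vin; have := s2 u0 v u0in vin; rewrite mulf_eq0 negb_or => /andP[h _].
    rewrite eq_sym; apply: (ne _ _ _ _ _ h); rewrite ?(nz v) //.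
    by rewrite invfM !invrK; ring.
  have n3 u : u \in us -> (q ^- 2 * u0^-1) ^+ 2 != (q ^+ 2 * u^-1) ^+ 2.
    move=> uin; have h := s3 u0 u u0in uin.
    rewrite eq_sym; apply: (ne _ _ _ _ _ h); rewrite ?z0 //.
    by rewrite invfM !invrK; ring.
  rewrite /roots !map_cat cat_uniq un /= cat_uniq; apply/and4P; split.
  + apply/hasPn => y; rewrite mem_cat => /orP[|].
      move=> /mapP[_ /mapP[u uin ->] ->]; apply/negP => /mapP[v vin] /eqP.
      by rewrite (negbTE (n1 u v uin vin)).
    case: (e) => //=; rewrite inE => /eqP->; apply/negP => /mapP[v vin] /eqP.
    by rewrite (negbTE (n2 v vin)).
  + rewrite -map_comp (eq_map (g := (fun y => q ^+ 4 * y^-1) \o (fun u => u ^+ 2))).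
      rewrite map_comp map_inj_uniq // => y y' /= /(mulfI (expf_neq0 4 q0)).
      exact: invr_inj.
    by move=> u /=; rewrite exprMn exprVn -exprM.
  + case: (e) => //=; rewrite orbF; apply/negP => /mapP[_ /mapP[u uin ->]] /eqP.
    by rewrite (negbTE (n3 u uin)).
  by case: (e).
rewrite !size_cat size_map; case: (e) => /=; lia.
Qed.

End Identity.

(** * From nested sums to orientations of the graph *)

Section Isum.
Variables (F : fieldType).

(* [(true, (i, j))] is the edge above [(i, j)], with value [true] if it points up;
   [(false, (i, j))] is the edge on the right of [(i, j)], with value [true] if it
   points right. *)
Definition var : eqType := (bool * (nat * nat))%type.
Definition vert i j : var := (true, (i, j)).
Definition horiz i j : var := (false, (i, j)).
Definition env := var -> bool.
Definition update (e : env) v b : env := fun w => if w == v then b else e w.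

(** Edges are named here, whereas [sum_states] knows states only by position; the names allow the
    summand to be read as a function of an orientation. *)
Fixpoint isum (vs : seq var) (G : env -> F) (e : env) : F :=
  if vs is v :: vs' then sum_bool (fun b => isum vs' G (update e v b)) else G e.

Lemma isum_cons v vs G e : isum (v :: vs) G e = sum_bool (fun b => isum vs G (update e v b)).
Proof. by []. Qed.

Lemma isum_cat vs ws G e : isum (vs ++ ws) G e = isum vs (isum ws G) e.
Proof. by elim: vs e => [|v vs IH] e //=; apply: eq_sum_bool => b. Qed.

Lemma eq_isum vs G G' e :
  (forall e', {in predC (mem vs), e' =1 e} -> G e' = G' e') ->
  isum vs G e = isum vs G' e.
Proof.
elim: vs e => [|v vs IH] e H' /=; first exact: H'.
apply: eq_sum_bool => b; apply: IH => e' he; apply: H' => w.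
rewrite inE /= inE negb_or => /andP[wv wvs].
by rewrite he // /update (negbTE wv).
Qed.

Lemma isumZ vs k G e : isum vs (fun e => k * G e) e = k * isum vs G e.
Proof. by elim: vs e => [|v vs IH] e //=; rewrite /sum_bool !IH mulrDr. Qed.

Lemma isum_frozen vs (K G : env -> F) e :
  (forall e', {in predC (mem vs), e' =1 e} -> K e' = K e) ->
  isum vs (fun e => K e * G e) e = K e * isum vs G e.
Proof. by move=> hK; rewrite -isumZ; apply: eq_isum => e' /hK ->. Qed.

Fixpoint read_column (e : env) r j : seq bool :=
  if r is r'.+1 then e (horiz r j) :: read_column e r' j else [::].

Lemma eq_read_column e e' r j : (forall i, (0 < i <= r)%N -> e (horiz i j) = e' (horiz i j)) ->
  read_column e r j = read_column e' r j.
Proof.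
elim: r => //= r IH h; rewrite h ?leqnn // IH // => i /andP[i0 ir].
by rewrite h // i0 ltnW.
Qed.

Fixpoint center_vars r j : seq var :=
  if r is r'.+1 then horiz r j :: center_vars r' j else [::].

Fixpoint right_col_vars r j : seq var :=
  if r is r'.+1 then [:: vert r j, horiz r j & right_col_vars r' j] else [::].

(* The left half is read from the centre outwards, so that a vertex produces the
   edge on its left. *)
Fixpoint left_col_vars r j : seq var :=
  if r is r'.+1 then [:: vert r j, horiz r j.-1 & left_col_vars r' j] else [::].

Fixpoint right_vars k j : seq var :=
  if k is k'.+1 then vert k j :: right_col_vars k' j ++ right_vars k' j.+1 else [::].

Fixpoint left_vars k : seq var :=
  if k is k'.+1 then vert k k :: left_col_vars k' k ++ left_vars k' else [::].

Lemma mem_center_vars v r j : (v \in center_vars r j) =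
  [&& ~~ v.1, (0 < v.2.1 <= r)%N & v.2.2 == j].
Proof.
case: v => b [i j']; elim: r => [|r IH] /=; first by rewrite in_nil; lia.
rewrite inE IH -pair_eqE /= -pair_eqE /=; case: b {IH}; lia.
Qed.

Lemma mem_right_col_vars v r j : (v \in right_col_vars r j) =
  (0 < v.2.1 <= r)%N && (v.2.2 == j).
Proof.
case: v => b [i j']; elim: r => [|r IH] /=; first by rewrite in_nil; lia.
rewrite !inE IH -!pair_eqE /= -!pair_eqE /=; case: b {IH}; lia.
Qed.

Lemma mem_left_col_vars v r j : (v \in left_col_vars r j) =
  (0 < v.2.1 <= r)%N && (v.2.2 == if v.1 then j else j.-1).
Proof.
case: v => b [i j']; elim: r => [|r IH] /=; first by rewrite in_nil; lia.
rewrite !inE IH -!pair_eqE /= -!pair_eqE /=; case: b {IH}; lia.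
Qed.

Lemma mem_right_vars v k j : (v \in right_vars k j) =
  [&& (0 < v.2.1)%N, (j <= v.2.2)%N & (v.2.1 + v.2.2 + ~~ v.1 <= k + j)%N].
Proof.
case: v => b [i j']; elim: k j => [|k IH] j /=; first by rewrite in_nil; lia.
rewrite inE mem_cat mem_right_col_vars IH -pair_eqE /= -pair_eqE /=; case: b {IH}; lia.
Qed.

Lemma mem_left_vars v k : (v \in left_vars k) =
  [&& (0 < v.2.1)%N, (v.2.1 <= v.2.2)%N & (v.2.2 + ~~ v.1 <= k)%N].
Proof.
case: v => b [i j']; elim: k => [|k IH] /=; first by rewrite in_nil; lia.
rewrite inE mem_cat mem_left_col_vars IH -pair_eqE /= -pair_eqE /=; case: b {IH}; lia.
Qed.

Lemma isum_center_vars r j Phi e :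
  isum (center_vars r j) (fun e => Phi (read_column e r j)) e = sum_states r Phi.
Proof.
elim: r Phi e => [|r IH] Phi e //=; apply: eq_sum_bool => b.
rewrite -(IH (fun t => Phi (b :: t)) (update e (horiz r.+1 j) b)); apply: eq_isum => e' he.
by rewrite he ?inE /= ?mem_center_vars /= ?ltnn ?andbF // /update eqxx.
Qed.

Variables (p q : F) (u : nat -> F).
Notation ice_weight := (ice_weight q). Notation column := (column q). Notation right_half
    := (right_half q).

Fixpoint rows r : seq F := if r is r'.+1 then u r :: rows r' else [::].

Lemma size_rows r : size (rows r) = r.
Proof. by elim: r => //= r ->. Qed.

Definition bulk_factor (x : F) r j (e : env) : F :=
  ice_weight (x * u r) (e (vert r.+1 j)) (e (horiz r j.-1)) (e (vert r j)) (e (horiz r j)).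

(** The base case is the indicator of an upward top edge, the counterpart of [if c] in [column]. *)
Fixpoint col_factor (x : F) r j (e : env) : F :=
  if r is r'.+1 then bulk_factor x r j e * col_factor x r' j e else (e (vert 1 j))%:R.

Fixpoint right_factor k j (e : env) : F :=
  if k is k'.+1 then
    right_weight p q (u k) (e (vert k j)) (~~ e (horiz k j.-1)) * col_factor (u k) k' j e *
        right_factor k' j.+1 e
  else 1.

Fixpoint left_factor k (e : env) : F :=
  if k is k'.+1 then
    left_weight p q (u k) (e (vert k k)) (e (horiz k k)) * col_factor (u k) k' k e *
        left_factor k' e
  else 1.

Lemma eq_col_factor x r j e e' :
  (forall i, (0 < i <= r.+1)%N -> e (vert i j) = e' (vert i j)) ->
  (forall i, (0 < i <= r)%N -> e (horiz i j) = e' (horiz i j) /\ e (horiz i j.-1) = e'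
      (horiz i j.-1)) ->
  col_factor x r j e = col_factor x r j e'.
Proof.
elim: r => [|r IH] hV hH /=; first by rewrite hV.
have [h1 h2] := hH r.+1 (leqnn _).
have v1 : e (vert r.+2 j) = e' (vert r.+2 j) by apply: hV; lia.
have v2 : e (vert r.+1 j) = e' (vert r.+1 j) by apply: hV; lia.
rewrite /bulk_factor h1 h2 v1 v2 IH // => i hi; first by apply: hV; lia.
by apply: hH; lia.
Qed.

Lemma eq_left_factor k e e' :
  (forall i j, (0 < i <= j)%N -> (j <= k)%N -> e (vert i j) = e' (vert i j) /\ e (horiz i
      j) = e' (horiz i j)) ->
  left_factor k e = left_factor k e'.
Proof.
elim: k => [|k IH] h //=; have [h1 h2] := h k.+1 k.+1 (leqnn _) (leqnn _).
rewrite h1 h2 IH => [|i j ij jk]; last by apply: h; lia.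
congr (_ * _ * _); apply: eq_col_factor => i hi; first by have [] := h i k.+1; lia.
have [_ h3] := h i k.+1 ltac:(lia) ltac:(lia).
by have [_ h4] := h i k ltac:(lia) ltac:(lia).
Qed.

Lemma isum_right_column x r j f e :
  isum (right_col_vars r j.+1) (fun e => col_factor x r j.+1 e * f (read_column e r j.+1)) e =
  column x (rows r) f (e (vert r.+1 j.+1)) (read_column e r j).
Proof.
elim: r f e => [|r IH] f e /=.
  by rewrite /column /=; case: (e _) => /=; rewrite ?mul1r ?mul0r.
rewrite /column /=; apply: eq_sum_bool => b; apply: eq_sum_bool => b'.
set e' := update _ _ _.
have E v : v != vert r.+1 j.+1 -> v != horiz r.+1 j.+1 -> e' v = e v.
  by rewrite /e' /update => /negbTE -> /negbTE ->.
have eV : e' (vert r.+1 j.+1) = b by rewrite /e' /update /= eqxx.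
have eH : e' (horiz r.+1 j.+1) = b' by rewrite /e' /update eqxx.
transitivity (bulk_factor x r.+1 j.+1 e' * isum (right_col_vars r j.+1)
   (fun e0 => col_factor x r j.+1 e0 * f (b' :: read_column e0 r j.+1)) e').
  rewrite -(@isum_frozen _ (bulk_factor x r.+1 j.+1)); last first.
    by move=> e0 h; rewrite /bulk_factor !h // inE /= mem_right_col_vars /=; lia.
  apply: eq_isum => e0 h; rewrite /bulk_factor !h ?eH -?mulrA //; rewrite inE /=
      mem_right_col_vars /=; lia.
rewrite (IH (fun t => f (b' :: t))) /bulk_factor eV eH /=.
rewrite !E; try by rewrite -pair_eqE /= -?pair_eqE /=; lia.
congr (_ * column _ _ _ _ _); apply: eq_read_column => i hi.
by apply: E; rewrite -pair_eqE /= -?pair_eqE /=; lia.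
Qed.

Lemma isum_left_column x r j f e :
  isum (left_col_vars r j.+1) (fun e => col_factor x r j.+1 e * f (map negb (read_column e
      r j))) e =
  column x^-1 (map GRing.inv (rows r)) f (e (vert r.+1 j.+1)) (map negb (read_column e r j.+1)).
Proof.
elim: r f e => [|r IH] f e /=.
  by rewrite /column /=; case: (e _) => /=; rewrite ?mul1r ?mul0r.
rewrite /column /=; apply: eq_sum_bool => b.
transitivity (sum_bool (fun b' => ice_weight (x^-1 * (u r.+1)^-1) (e (vert r.+2 j.+1)) (~~
    e (horiz r.+1 j.+1)) b (~~ b') *
  column x^-1 (map GRing.inv (rows r)) (fun t => f (~~ b' :: t)) b (map negb (read_column e
      r j.+1)))); last first.
  (* The states of the mirror image are negated, so the two summands trade places. *)
  by rewrite /sum_bool addrC.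
apply: eq_sum_bool => b'.
set e' := update _ _ _.
have E v : v != vert r.+1 j.+1 -> v != horiz r.+1 j -> e' v = e v.
  by rewrite /e' /update => /negbTE -> /negbTE ->.
have eV : e' (vert r.+1 j.+1) = b by rewrite /e' /update /= eqxx.
have eH : e' (horiz r.+1 j) = b' by rewrite /e' /update eqxx.
transitivity (bulk_factor x r.+1 j.+1 e' * isum (left_col_vars r j.+1)
   (fun e0 => col_factor x r j.+1 e0 * f (~~ b' :: map negb (read_column e0 r j))) e').
  rewrite -(@isum_frozen _ (bulk_factor x r.+1 j.+1)); last first.
    by move=> e0 h; rewrite /bulk_factor !h // inE /= mem_left_col_vars /=; lia.
  apply: eq_isum => e0 h; rewrite /bulk_factor !h ?eH -?mulrA //; rewrite inE /=
      mem_left_col_vars /=; lia.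
rewrite (IH (fun t => f (~~ b' :: t))) /bulk_factor eV eH /=.
rewrite !E; try by rewrite -pair_eqE /= -?pair_eqE /=; lia.
rewrite ice_weight_mirror invfM; congr (_ * column _ _ _ _ (map _ _)); apply:
    eq_read_column => i hi.
by apply: E; rewrite -pair_eqE /= -?pair_eqE /=; lia.
Qed.

Lemma isum_right k j e :
  isum (right_vars k j.+1) (right_factor k j.+1) e = right_half p (rows k) (read_column e k j).
Proof.
elim: k j e => [|k IH] j e //=.
apply: eq_sum_bool => b; rewrite isum_cat; set e' := update _ _ _.
have E v : v != vert k.+1 j.+1 -> e' v = e v by rewrite /e' /update => /negbTE ->.
have eV : e' (vert k.+1 j.+1) = b by rewrite /e' /update /= eqxx.
transitivity (right_weight p q (u k.+1) b (~~ e (horiz k.+1 j)) *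
  isum (right_col_vars k j.+1) (fun e => col_factor (u k.+1) k j.+1 e * right_half p (rows
      k) (read_column e k j.+1)) e').
  rewrite -isumZ; apply: eq_isum => e1 h1.
  transitivity (right_weight p q (u k.+1) (e1 (vert k.+1 j.+1)) (~~ e1 (horiz k.+1 j)) *
      col_factor (u k.+1) k j.+1 e1
     * isum (right_vars k j.+2) (right_factor k j.+2) e1).
    rewrite -(@isum_frozen _ (fun e1 => right_weight p q (u k.+1) (e1 (vert k.+1 j.+1))
      (~~ e1 (horiz k.+1 j)) * col_factor (u k.+1) k j.+1 e1)) // => e2 h2.
    rewrite !h2; try by rewrite inE /= mem_right_vars /=; lia.
    congr (_ * _); apply: eq_col_factor => i hi; rewrite !h2 //; rewrite inE /=
        mem_right_vars /=; lia.
  rewrite IH !h1; try by rewrite inE /= mem_right_col_vars /=; lia.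
  by rewrite eV E ?mulrA // -pair_eqE.
rewrite isum_right_column eV; congr (_ * column _ _ _ _ _); apply: eq_read_column => i hi.
by apply: E; rewrite -pair_eqE.
Qed.

(** The left boundary weights are the right ones with [p] and the label inverted. *)
Lemma isum_left k e :
  isum (left_vars k) (left_factor k) e =
  right_half p^-1 (map GRing.inv (rows k)) (map negb (read_column e k k)).
Proof.
elim: k e => [|k IH] e //=.
apply: eq_sum_bool => b; rewrite isum_cat; set e' := update _ _ _.
have E v : v != vert k.+1 k.+1 -> e' v = e v by rewrite /e' /update => /negbTE ->.
have eV : e' (vert k.+1 k.+1) = b by rewrite /e' /update /= eqxx.
transitivity (left_weight p q (u k.+1) b (e (horiz k.+1 k.+1)) *
  isum (left_col_vars k k.+1) (fun e => col_factor (u k.+1) k k.+1 e *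
     right_half p^-1 (map GRing.inv (rows k)) (map negb (read_column e k k))) e').
  rewrite -isumZ; apply: eq_isum => e1 h1.
  transitivity (left_weight p q (u k.+1) (e1 (vert k.+1 k.+1)) (e1 (horiz k.+1 k.+1)) *
      col_factor (u k.+1) k k.+1 e1
     * isum (left_vars k) (left_factor k) e1).
    rewrite -(@isum_frozen _ (fun e1 => left_weight p q (u k.+1) (e1 (vert k.+1 k.+1))
      (e1 (horiz k.+1 k.+1)) * col_factor (u k.+1) k k.+1 e1)) // => e2 h2.
    rewrite !h2; try by rewrite inE /= mem_left_vars /=; lia.
    congr (_ * _); apply: eq_col_factor => i hi; rewrite !h2 //; rewrite inE /=
        mem_left_vars /=; lia.
  rewrite IH !h1; try by rewrite inE /= mem_left_col_vars /=; lia.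
  by rewrite eV E ?mulrA // -pair_eqE.
rewrite isum_left_column eV negbK (@eq_read_column e' e); last first.
  by move=> i hi; apply: E; rewrite -pair_eqE.
congr (_ * _); by rewrite /left_weight /right_weight !invrK.
Qed.

(* The order in which the nested sums of [Z_end] bind the edges: every factor can be
   pulled out of the sums over the edges that come later. *)
Definition all_vars n : seq var :=
  center_vars n n ++ left_vars n ++ vert n.+1 n.+1 :: right_col_vars n n.+1 ++ right_vars n
      n.+2.

Lemma isum_all_vars n e :
  isum (all_vars n) (fun e => left_factor n e * col_factor (u n.+1) n n.+1 e * right_factor
      n n.+2 e) e =
  sum_bool (Z_end q p (u n.+1) (rows n)).
Proof.
rewrite /all_vars isum_cat /Z_end size_rows -sum_states_bool.
pose Phi s := sum_bool (fun c => column (u n.+1) (rows n) (right_half p (rows n)) c s *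
   right_half p^-1 (map GRing.inv (rows n)) (map negb s)).
rewrite -(isum_center_vars n n Phi e); apply: eq_isum => {}e _.
pose Psi e := sum_bool (fun c => column (u n.+1) (rows n) (right_half p (rows n)) c
    (read_column e n n)).
transitivity (isum (left_vars n) (fun e1 => Psi e * left_factor n e1) e); last first.
  by rewrite isumZ isum_left /Phi /Psi /sum_bool mulrDl.
rewrite isum_cat; apply: eq_isum => e1 h1.
have -> : Psi e = Psi e1.
  apply: eq_sum_bool => c; congr (column _ _ _ _ _); apply: eq_read_column => i hi.
  by rewrite h1 // inE /= mem_left_vars /=; lia.
rewrite mulrC; transitivity (left_factor n e1 *
  isum (vert n.+1 n.+1 :: right_col_vars n n.+1 ++ right_vars n n.+2)
    (fun e => col_factor (u n.+1) n n.+1 e * right_factor n n.+2 e) e1).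
  rewrite -(@isum_frozen _ (left_factor n)) => [|e2 h2].
    by apply: eq_isum => e2 _; rewrite mulrA.
  apply: eq_left_factor => i j ij jn; rewrite !h2 //;
    by rewrite inE /= inE mem_cat mem_right_col_vars mem_right_vars -pair_eqE /= -?pair_eqE
        /=; lia.
congr (_ * _); rewrite isum_cons; apply: eq_sum_bool => c; rewrite isum_cat.
rewrite -[c in RHS](_ : update e1 (vert n.+1 n.+1) c (vert n.+1 n.+1) = c); last first.
  by rewrite /update eqxx.
rewrite (@eq_read_column e1 (update e1 (vert n.+1 n.+1) c)) => [|i hi]; last first.
  by rewrite /update -pair_eqE.
rewrite -isum_right_column; apply: eq_isum => e2 h2.
rewrite -isum_right -(@isum_frozen _ (col_factor (u n.+1) n n.+1)) // => e3 h3.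
by apply: eq_col_factor => i hi; rewrite !h3 // inE /= mem_right_vars /=; lia.
Qed.

End Isum.

Lemma uniq_center_vars r j : uniq (center_vars r j).
Proof. by elim: r => //= r ->; rewrite mem_center_vars /=; lia. Qed.

Lemma uniq_right_col_vars r j : uniq (right_col_vars r j).
Proof. by elim: r => //= r ->; rewrite inE !mem_right_col_vars -pair_eqE /=; lia. Qed.

Lemma uniq_left_col_vars r j : uniq (left_col_vars r j).
Proof. by elim: r => //= r ->; rewrite inE !mem_left_col_vars -pair_eqE /=; lia. Qed.

Lemma uniq_right_vars k j : uniq (right_vars k j).
Proof.
elim: k j => //= k IH j; rewrite mem_cat mem_right_col_vars mem_right_vars /= cat_uniq IH
    uniq_right_col_vars andbT /=.
apply/andP; split; first by lia.
by apply/hasPn => -[b [i j']]; rewrite mem_right_vars /= mem_right_col_vars /=; case: b; lia.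
Qed.

Lemma uniq_left_vars k : uniq (left_vars k).
Proof.
elim: k => //= k IH; rewrite mem_cat mem_left_col_vars mem_left_vars /= cat_uniq IH
    uniq_left_col_vars andbT /=.
apply/andP; split; first by lia.
by apply/hasPn => -[b [i j]]; rewrite mem_left_vars /= mem_left_col_vars /=; case: b; lia.
Qed.

Lemma mem_all_vars n v : (v \in all_vars n) =
  [&& (0 < v.2.1)%N, (v.2.1 <= v.2.2)%N & (v.2.1 + v.2.2 + ~~ v.1 <= 2 * n + 2)%N].
Proof.
case: v => b [i j].
rewrite /all_vars !mem_cat inE mem_cat mem_center_vars mem_left_vars mem_right_col_vars
    mem_right_vars.
rewrite -pair_eqE /= -pair_eqE /=; case: b; lia.
Qed.

Lemma uniq_all_vars n : uniq (all_vars n).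
Proof.
rewrite /all_vars cat_uniq uniq_center_vars andTb; apply/andP; split.
  apply/hasPn => -[b [i j]]; rewrite mem_cat inE mem_cat mem_left_vars mem_right_col_vars
      mem_right_vars.
  by rewrite /= mem_center_vars -pair_eqE /= -pair_eqE /=; case: b; lia.
rewrite cat_uniq uniq_left_vars andTb; apply/andP; split.
  apply/hasPn => -[b [i j]]; rewrite inE mem_cat mem_right_col_vars mem_right_vars.
  by rewrite /= mem_left_vars -pair_eqE /= -pair_eqE /=; case: b; lia.
rewrite cons_uniq mem_cat mem_right_col_vars mem_right_vars cat_uniq uniq_right_col_vars
    uniq_right_vars andbT.
apply/andP; split; first by rewrite /=; lia.
by apply/hasPn => -[b [i j]]; rewrite mem_right_vars /= mem_right_col_vars /=; case: b; lia.
Qed.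

(** * Edge assignments as orientations *)

Section Subsets.
Variables (F : fieldType) (T : finType) (arc : var -> T).

Definition true_arcs (vs : seq var) (e : env) : {set T} :=
  [set a | has (fun v => e v && (arc v == a)) vs].

(** Distinct edges have distinct arcs, so an assignment amounts to the set of its true arcs; subsets
    are split by whether they contain the arc of the first edge. *)
Lemma isum_subsets vs (g : {set T} -> F) e : uniq (map arc vs) ->
  isum vs (fun e => g (true_arcs vs e)) e =
  \sum_(B : {set T} | B \subset [set a in map arc vs]) g B.
Proof.
elim: vs g e => [|v vs IH] g e /=.
  move=> _; rewrite (big_pred1 set0) /=.
    by congr g; apply/setP => a; rewrite !inE.
  by move=> B /=; rewrite -subset0; congr (_ \subset _); apply/setP => a; rewrite !inE.
move=> /andP[av uvs]; have vvs : v \notin vs by apply: contra av; exact: map_f.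
have nD : arc v \notin [set a in map arc vs] by rewrite inE.
rewrite (bigID (fun B : {set T} => arc v \in B)) /=; congr (_ + _).
  rewrite (reindex_onto (fun B => arc v |: B) (fun B => B :\ arc v)) /=; last first.
    by move=> B /andP[_ h]; rewrite setD1K.
  transitivity (isum vs (fun e => g (arc v |: true_arcs vs e)) (update e v true)).
    apply: eq_isum => e' he; congr g; apply/setP => a.
    by rewrite !inE /= he ?inE //= /update eqxx eq_sym.
  rewrite (IH (fun B => g (arc v |: B))) //; apply: eq_bigl => B.
  rewrite setU11 andbT; apply/idP/andP => [BD|[/subsetP BD /eqP e']].
    split; last by rewrite setU1K //; apply: contra nD => /(subsetP BD).
    by apply/subsetP => a; rewrite !inE => /orP[->//|/(subsetP BD)]; rewrite inE => ->;
        rewrite orbT.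
  apply/subsetP => a aB; have := BD a; rewrite !inE aB orbT => /(_ isT) /orP[/eqP ae|//].
  by move: aB; rewrite ae -e' !inE eqxx.
transitivity (isum vs (fun e => g (true_arcs vs e)) (update e v false)).
  apply: eq_isum => e' he; congr g; apply/setP => a.
  by rewrite !inE /= he ?inE //= /update eqxx.
rewrite IH //; apply: eq_bigl => B; apply/idP/andP => [BD|[/subsetP BD aB]].
  split; last by apply: contra nD => /(subsetP BD).
  by apply/subsetP => a /(subsetP BD); rewrite !inE => ->; rewrite orbT.
apply/subsetP => a aB'; have := BD a aB'; rewrite !inE => /orP[/eqP ae|//].
by rewrite ae (negbTE aB) in aB'.
Qed.
End Subsets.

Section Orientations.
Variable n : nat.
Notation grid := (grid n).

Definition ref_arcs : {set grid * grid} := [set a | vedge a.2 a.1 || hedge a.1 a.2].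

(* An orientation is recovered from those of its arcs that point up or to the right. *)
Definition orient (B : {set grid * grid}) : {set grid * grid} :=
  [set a | if a \in ref_arcs then a \in B
           else ((a.2, a.1) \in ref_arcs) && ((a.2, a.1) \notin B)].

Lemma in_orient B x y : ((x, y) \in orient B) =
  if (x, y) \in ref_arcs then (x, y) \in B else ((y, x) \in ref_arcs) && ((y, x) \notin B).
Proof. by rewrite in_set. Qed.

Lemma ref_arcs_coord x y : (x, y) \in ref_arcs ->
  (x.1 == y.1.+1 :> nat) && (x.2 == y.2 :> nat) ||
  (x.1 == y.1 :> nat) && (y.2 == x.2.+1 :> nat).
Proof.
rewrite inE /vedge /hedge /= => /orP[/and4P[_ _ /eqP -> /eqP ->]|/and5P[_ _ _ /eqP -> /eqP ->]].
  by rewrite !eqxx.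
by rewrite !eqxx orbT.
Qed.

Lemma ref_arcs_asym x y : (x, y) \in ref_arcs -> (y, x) \in ref_arcs = false.
Proof.
move=> /ref_arcs_coord h; apply/negbTE; apply/negP => /ref_arcs_coord; lia.
Qed.

Lemma adjacentE x y : adjacent x y = ((x, y) \in ref_arcs) || ((y, x) \in ref_arcs).
Proof. by rewrite !inE /= /adjacent; do !case: vedge; do !case: hedge. Qed.

(** The inverse of [orient] is intersection with [ref_arcs]. *)
Lemma big_orientation (F : fieldType) (g : {set grid * grid} -> F) :
  \sum_(A | orientation A) g A = \sum_(B : {set grid * grid} | B \subset ref_arcs) g (orient B).
Proof.
have OP (A : {set grid * grid}) : reflect (forall x y, if adjacent x y then ((x, y) \in A)
    (+) ((y, x) \in A)
    else (x, y) \notin A) (orientation A).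
  by apply: (iffP forallP) => h x; [have /forallP := h x; exact|apply/forallP; exact: h].
rewrite (reindex_onto orient (fun A => A :&: ref_arcs)) /=; last first.
  move=> A /OP hA; apply/setP => -[x y]; rewrite in_orient.
  have := hA x y; rewrite adjacentE !in_setI.
  case xy: ((x, y) \in ref_arcs) => /=; first by rewrite andbT.
  case yx: ((y, x) \in ref_arcs) => /=; last by move/negbTE->.
  by rewrite andbT; case: (_ \in A); case: (_ \in A).
apply: eq_bigl => B; apply/andP/idP => [[_ /eqP <-]|BD]; first exact: subsetIr.
split.
  apply/OP => x y; rewrite adjacentE !in_orient.
  case xy: ((x, y) \in ref_arcs) => /=.
    by rewrite (ref_arcs_asym xy) /=; case: (_ \in B).
  case yx: ((y, x) \in ref_arcs) => //=.
  by case: (_ \in B).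
apply/eqP/setP => -[x y]; rewrite in_setI in_orient.
case: ifP => [_|h]; first by rewrite andbT.
by rewrite andbF; apply/esym/negbTE; apply: contraFN h => /(subsetP BD).
Qed.

End Orientations.

Section Arcs.
Variable n : nat.
Notation grid := (grid n).
Notation node := (node n).

Lemma node_row i j : (i <= n.+1)%N -> (node i j).1 = i :> nat.
Proof. by move=> h; rewrite inordK. Qed.

Lemma node_col i j : (j <= (2 * n).+1)%N -> (node i j).2 = j :> nat.
Proof. by move=> h; rewrite inordK. Qed.

Lemma nodeE (x : grid) i j : x.1 = i :> nat -> x.2 = j :> nat -> x = node i j.
Proof. by case: x => a b /= <- <-; rewrite /node !inord_val. Qed.

Definition edge_arc (v : var) : grid * grid :=
  if v.1 then (node v.2.1 v.2.2, node v.2.1.-1 v.2.2)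
  else (node v.2.1 v.2.2, node v.2.1 v.2.2.+1).

Lemma ref_arcsE : ref_arcs n = [set a in map edge_arc (all_vars n)].
Proof.
apply/setP => -[x y]; rewrite !inE /=; apply/idP/mapP.
  case/orP => [/and4P[vx vy /eqP e1 /eqP e2]|/and5P[vx vy x0 /eqP e1 /eqP e2]].
    exists (vert x.1 x.2); last first.
      by rewrite /edge_arc /= -(@nodeE x) // -(@nodeE y) // e1.
    rewrite mem_all_vars /=; move: vx vy e1 e2; rewrite /vertex /=.
    move: (nat_of_ord x.1) (nat_of_ord x.2) (nat_of_ord y.1) (nat_of_ord y.2) => a b c d; lia.
  exists (horiz x.1 x.2); last first.
    by rewrite /edge_arc /= -(@nodeE x) // -(@nodeE y) // e1.
  rewrite mem_all_vars /=; move: vx vy x0 e1 e2; rewrite /vertex /=.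
  move: (nat_of_ord x.1) (nat_of_ord x.2) (nat_of_ord y.1) (nat_of_ord y.2) => a b c d; lia.
case=> -[b [i j]]; rewrite mem_all_vars /edge_arc /= => hv.
case: b hv => /= hv [-> ->].
  rewrite /vedge /vertex !node_row ?node_col; lia.
apply/orP; right; rewrite /hedge /vertex !node_row ?node_col; lia.
Qed.

Lemma edge_arc_inj : {in all_vars n &, injective edge_arc}.
Proof.
move=> [b [i j]] [b' [i' j']]; rewrite !mem_all_vars /= => h h' E.
have arc1 v : (edge_arc v).1 = node v.2.1 v.2.2 by rewrite /edge_arc; case: v.1.
have := congr1 fst E; rewrite !arc1 /= => E1.
have ii' : i = i' by move: (congr1 (fun x : grid => nat_of_ord x.1) E1); rewrite !node_row; lia.
have jj' : j = j' by move: (congr1 (fun x : grid => nat_of_ord x.2) E1); rewrite !node_col; lia.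
move: (congr1 (fun a : grid * grid => nat_of_ord a.2.1) E); rewrite -ii' -jj' /edge_arc.
by case: b b' h h' {E} => [] [] //= h h'; rewrite !inordK;
  first [lia | move=> ?; exfalso; lia].
Qed.

Lemma uniq_edge_arcs : uniq (map edge_arc (all_vars n)).
Proof. by rewrite map_inj_in_uniq ?uniq_all_vars //; exact: edge_arc_inj. Qed.

Definition orient_of (e : env) := orient (true_arcs edge_arc (all_vars n) e).

Lemma edge_arc_orient_of e v : v \in all_vars n -> (edge_arc v \in orient_of e) = e v.
Proof.
move=> vin; rewrite /orient_of [edge_arc v]surjective_pairing in_orient -surjective_pairing.
rewrite ref_arcsE inE map_f // inE; apply/hasP/idP => [[w win /andP[bulk_factor /eqP aw]]|ev].
  by rewrite -(edge_arc_inj win vin aw).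
by exists v; rewrite ?ev ?eqxx.
Qed.

Lemma rev_edge_arc_orient_of e v : v \in all_vars n ->
  (((edge_arc v).2, (edge_arc v).1) \in orient_of e) = ~~ e v.
Proof.
move=> vin; have := edge_arc_orient_of e vin.
have h : ((edge_arc v).1, (edge_arc v).2) \in ref_arcs n by rewrite -surjective_pairing
    ref_arcsE inE map_f.
rewrite [X in (X \in _)]surjective_pairing !in_orient h (ref_arcs_asym h).
by move=> <-.
Qed.

Lemma big_orientation_isum (F : fieldType) (g : {set grid * grid} -> F) e :
  \sum_(A | orientation A) g A = isum (all_vars n) (fun e => g (orient_of e)) e.
Proof.
by rewrite big_orientation (isum_subsets (fun B => g (orient B)) e uniq_edge_arcs) ref_arcsE.
Qed.

Lemma card_eq_count (T : finType) (P : pred T) (l : seq T) : uniq l ->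
  (forall y, P y -> y \in l) -> #|[set y | P y]| = count P l.
Proof.
move=> ul h; rewrite -size_filter -(card_uniqP (filter_uniq P ul)).
by apply: eq_card => y; rewrite inE mem_filter; case: (boolP (P y)) => // /h ->.
Qed.

(** Let [c], [b] be the states below and on the left, [c'], [b'] those above and on the right. The
    in-degree is [c + b + (1 - c') + (1 - b')], which is 2 exactly under conservation. *)
Lemma ice_orient_of e i j : (0 < i <= n)%N -> (i < j < 2 * n + 2 - i)%N ->
  ((#|[set y | (y, node i j) \in orient_of e]| == 2) &&
   (#|[set y | (node i j, y) \in orient_of e]| == 2)) =
  (e (vert i.+1 j) + e (horiz i j.-1) == e (vert i j) + e (horiz i j))%N.
Proof.
move=> hi hj; set x := node i j.
pose l := [:: node i.-1 j; node i.+1 j; node i j.-1; node i j.+1].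
have ul : uniq l.
  rewrite /l /= !inE -!pair_eqE /= /pair_eq /= -!val_eqE /= !inordK; lia.
have near y : ((y, x) \in ref_arcs n) || ((x, y) \in ref_arcs n) -> y \in l.
  have [x1 x2] : x.1 = i :> nat /\ x.2 = j :> nat by rewrite node_row ?node_col; lia.
  move=> hxy; have : [\/ y = node i.-1 j, y = node i.+1 j, y = node i j.-1 | y = node i j.+1].
    case/orP: hxy => /ref_arcs_coord /orP[] /andP[/eqP h1 /eqP h2].
    - by apply: Or42; apply: nodeE; lia.
    - by apply: Or43; apply: nodeE; lia.
    - by apply: Or41; apply: nodeE; lia.
    - by apply: Or44; apply: nodeE; lia.
  by rewrite /l !inE => -[] ->; rewrite eqxx ?orbT.
have oin a b : (a, b) \in orient_of e -> ((a, b) \in ref_arcs n) || ((b, a) \in ref_arcs n).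
  by rewrite in_orient; case: ifP => //= _ /andP[].
rewrite (card_eq_count ul) => [|y /oin]; last exact: near.
rewrite (card_eq_count ul) => [|y /oin]; last by rewrite orbC; exact: near.
have vin b i' j' : (0 < i')%N -> (i' <= j')%N -> (i' + j' + ~~ b <= 2 * n + 2)%N ->
    (b, (i', j')) \in all_vars n by move=> *; rewrite mem_all_vars /=; lia.
have v1 : vert i j \in all_vars n by apply: vin => /=; lia.
have v2 : vert i.+1 j \in all_vars n by apply: vin => /=; lia.
have v3 : horiz i j.-1 \in all_vars n by apply: vin => /=; lia.
have v4 : horiz i j \in all_vars n by apply: vin => /=; lia.
have j0 : j.-1.+1 = j by lia.
have := (edge_arc_orient_of e v1, edge_arc_orient_of e v2, edge_arc_orient_of e v3,
    edge_arc_orient_of e v4).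
have := (rev_edge_arc_orient_of e v1, rev_edge_arc_orient_of e v2, rev_edge_arc_orient_of e
    v3, rev_edge_arc_orient_of e v4).
rewrite /edge_arc /= j0 -/x => -[[[r1 r2] r3] r4] [[[a1 a2] a3] a4].
rewrite /l /= r1 r2 r3 r4 a1 a2 a3 a4 {r1 r2 r3 r4 a1 a2 a3 a4}.
by case: (e (vert i j)); case: (e (vert i.+1 j)); case: (e (horiz i j.-1)); case: (e (horiz
    i j)).
Qed.

End Arcs.

(** * The weight of a configuration as a product over vertices *)

Fixpoint col_points r j : seq (nat * nat) := if r is r'.+1 then (r, j) :: col_points r' j
    else [::].

Fixpoint right_points k j : seq (nat * nat) :=
  if k is k'.+1 then (k, j) :: col_points k' j ++ right_points k' j.+1 else [::].

Fixpoint left_points k : seq (nat * nat) :=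
  if k is k'.+1 then (k, k) :: col_points k' k ++ left_points k' else [::].

Definition all_points n := left_points n ++ col_points n n.+1 ++ right_points n n.+2.

Lemma mem_col_points i j' r j : ((i, j') \in col_points r j) = (0 < i <= r)%N && (j' == j).
Proof.
elim: r => [|r IH] /=; first by rewrite in_nil; lia.
by rewrite !inE IH -!pair_eqE /=; lia.
Qed.

Lemma mem_right_points i j' k j : ((i, j') \in right_points k j) =
  [&& (0 < i)%N, (j <= j')%N & (i + j' <= k + j)%N].
Proof.
elim: k j => [|k IH] j /=; first by rewrite in_nil; lia.
by rewrite inE mem_cat mem_col_points IH -pair_eqE /=; lia.
Qed.

Lemma mem_left_points i j' k : ((i, j') \in left_points k) = (0 < i <= j')%N && (j' <= k)%N.
Proof.
elim: k => [|k IH] /=; first by rewrite in_nil; lia.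
by rewrite inE mem_cat mem_col_points IH -pair_eqE /=; lia.
Qed.

Lemma mem_all_points n i j : ((i, j) \in all_points n) = (0 < i <= n)%N && (i <= j <= 2 * n
    + 2 - i)%N.
Proof. rewrite /all_points !mem_cat mem_col_points mem_right_points mem_left_points; lia. Qed.

Lemma uniq_col_points r j : uniq (col_points r j).
Proof. by elim: r => //= r ->; rewrite mem_col_points; lia. Qed.

Lemma uniq_right_points k j : uniq (right_points k j).
Proof.
elim: k j => //= k IH j; rewrite mem_cat mem_col_points mem_right_points cat_uniq IH
    uniq_col_points andbT.
apply/andP; split; first by lia.
by apply/hasPn => -[i j']; rewrite mem_right_points /= mem_col_points; lia.
Qed.

Lemma uniq_left_points k : uniq (left_points k).
Proof.
elim: k => //= k IH; rewrite mem_cat mem_col_points mem_left_points cat_uniq IH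
    uniq_col_points andbT.
apply/andP; split; first by lia.
by apply/hasPn => -[i j']; rewrite mem_left_points /= mem_col_points; lia.
Qed.

Lemma uniq_all_points n : uniq (all_points n).
Proof.
rewrite /all_points !cat_uniq uniq_left_points uniq_col_points uniq_right_points andbT /=;
    apply/andP; split.
  by apply/hasPn => -[i j]; rewrite mem_cat mem_col_points mem_right_points /=
      mem_left_points; lia.
by apply/hasPn => -[i j]; rewrite mem_right_points /= mem_col_points; lia.
Qed.

Section Products.
Variables (F : fieldType) (p q : F) (n : nat) (u : nat -> F).
Notation ind e j := ((e (vert 1 j))%:R : F).

Definition vertex_factor (e : env) (z : nat * nat) : F :=
  let: (i, j) := z in
  if (i < j < 2 * n + 2 - i)%N then
    ice_weight q (u i * u (minn j (2 * n + 2 - j)))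
       (e (vert i.+1 j)) (e (horiz i j.-1)) (e (vert i j)) (e (horiz i j))
  else if j == i then left_weight p q (u i) (e (vert i j)) (e (horiz i j))
  else right_weight p q (u i) (e (vert i j)) (~~ e (horiz i j.-1)).

Lemma col_factor_prod e k r j : (r < j)%N -> (j + r < 2 * n + 2)%N -> minn j (2 * n + 2 -
    j) = k ->
  col_factor q u (u k) r j e = \prod_(z <- col_points r j) vertex_factor e z * ind e j.
Proof.
move=> rj jr mk; elim: r rj jr => [|r IH] rj jr; first by rewrite /= big_nil mul1r.
rewrite /= big_cons IH; try lia.
have -> : vertex_factor e (r.+1, j) = bulk_factor q u (u k) r.+1 j e.
  have h : (r.+1 < j < 2 * n + 2 - r.+1)%N by lia.
  by rewrite /vertex_factor h mk /bulk_factor mulrC.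
by rewrite mulrA.
Qed.

Lemma right_factor_prod e k j : (k + j = 2 * n + 2)%N -> (k <= n)%N ->
  right_factor p q u k j e = \prod_(z <- right_points k j) vertex_factor e z * \prod_(i <-
      iota j k) ind e i.
Proof.
elim: k j => [|k IH] j kj kn /=; first by rewrite !big_nil mulr1.
rewrite !big_cons big_cat IH /=; try lia.
rewrite (@col_factor_prod e k.+1 k j); try lia.
rewrite /vertex_factor (_ : (_ < j < _)%N = false); last lia.
rewrite (_ : (j == k.+1) = false); last lia.
by ring.
Qed.

Lemma left_factor_prod e k : (k <= n)%N ->
  left_factor p q u k e = \prod_(z <- left_points k) vertex_factor e z * \prod_(i <- rev
      (iota 1 k)) ind e i.
Proof.
elim: k => [|k IH] kn; first by rewrite /= !big_nil mulr1.
rewrite -addn1 iotaD rev_cat addn1 add1n /= !big_cons big_cat IH /=; try lia.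
rewrite (@col_factor_prod e k.+1 k k.+1); try lia.
rewrite /vertex_factor ltnn /= eqxx.
by ring.
Qed.

Lemma weight_prod e :
  left_factor p q u n e * col_factor q u (u n.+1) n n.+1 e * right_factor p q u n n.+2 e =
  \prod_(z <- all_points n) vertex_factor e z * \prod_(j <- iota 1 (2 * n).+1) ind e j.
Proof.
rewrite left_factor_prod // (@col_factor_prod e n.+1) ?right_factor_prod; try lia.
have -> : iota 1 (2 * n).+1 = iota 1 n ++ n.+1 :: iota n.+2 n.
  have -> : ((2 * n).+1 = n + (1 + n))%N by lia.
  by rewrite iotaD iotaD /= add1n addn1.
have -> : \prod_(i <- rev (iota 1 n)) ind e i = \prod_(i <- iota 1 n) ind e i.
  by apply: perm_big; rewrite perm_rev.
rewrite /all_points !big_cat /= big_cons.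
by ring.
Qed.

Lemma prod_ind (T : Type) (s : seq T) (b : T -> bool) :
  \prod_(i <- s) ((b i)%:R : F) = (all b s)%:R.
Proof.
elim: s => [|i s IH]; first by rewrite big_nil.
by rewrite big_cons IH /=; case: (b i); rewrite ?mul1r ?mul0r.
Qed.

Definition ice (A : {set grid n * grid n}) (x : grid n) : bool :=
  (#|[set y | (y, x) \in A]| == 2) && (#|[set y | (x, y) \in A]| == 2).

Definition top_up (A : {set grid n * grid n}) : bool :=
  [forall x : grid n, forall y : grid n, (x.1 == 0 :> nat)%N && vedge x y ==> ((y, x) \in A)].

Lemma top_up_orient_of e :
  top_up (orient_of n e) = all (fun j => e (vert 1 j)) (iota 1 (2 * n).+1).
Proof.
have vin j : (0 < j <= (2 * n).+1)%N -> vert 1 j \in all_vars n.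
  by move=> h; rewrite mem_all_vars /=; lia.
apply/forallP/allP => [h j|h x].
  rewrite mem_iota => hj; have := edge_arc_orient_of e (vin j ltac:(lia)); rewrite
      /edge_arc /= => <-.
  have /forallP/(_ (node n 1 j))/implyP := h (node n 0 j); apply.
  rewrite /vedge /vertex !node_row ?node_col //; lia.
apply/forallP => y; apply/implyP => /andP[/eqP x0 /and4P[vx vy /eqP y1 /eqP y2]].
have hj : (0 < x.2 <= (2 * n).+1)%N.
  by move: vx; rewrite /vertex x0; lia.
have hin : nat_of_ord x.2 \in iota 1 (2 * n).+1.
  by rewrite mem_iota; move: hj; move: (nat_of_ord x.2) => a; lia.
have := edge_arc_orient_of e (vin x.2 hj); rewrite (h _ hin) /edge_arc /=.
by rewrite -(@nodeE _ y) ?y1 ?x0 // -(@nodeE _ x).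
Qed.

(** The indicator makes the ice rule part of the weight, in agreement with [ice_weight], which is 0
    off the conservation law. *)
Lemma vertex_weight_orient_of e i j : (i, j) \in all_points n ->
  let x := node n i j in
  vertex_weight p q u (orient_of n e) x * (bulk x ==> ice (orient_of n e) x)%:R =
      vertex_factor e (i, j).
Proof.
rewrite mem_all_points => hij /=.
have vin b i' j' : (0 < i')%N -> (i' <= j')%N -> (i' + j' + ~~ b <= 2 * n + 2)%N ->
    (b, (i', j')) \in all_vars n by move=> *; rewrite mem_all_vars /=; lia.
have r : (node n i j).1 = i :> nat by rewrite node_row //; lia.
have c : (node n i j).2 = j :> nat by rewrite node_col //; lia.
have aboveE : above_up (orient_of n e) i j = e (vert i j).
  by have := edge_arc_orient_of e (vin true i j ltac:(lia) ltac:(lia) ltac:(rewrite /=; lia)).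
have bE : bulk (node n i j) = (i < j < 2 * n + 2 - i)%N.
  by rewrite /bulk r c; lia.
have lE : left_boundary (node n i j) = (j == i) by rewrite /left_boundary r c; lia.
rewrite /vertex_weight r c bE lE; case: ifP => [hb|hb] /=.
  rewrite /ice ice_orient_of //; last lia.
  rewrite /ice_weight aboveE.
  have -> : below_up (orient_of n e) i j = e (vert i.+1 j).
    by have := edge_arc_orient_of e (vin true i.+1 j ltac:(lia) ltac:(lia) ltac:(rewrite
        /=; lia)).
  have -> : left_rightward (orient_of n e) i j = e (horiz i j.-1).
    have := edge_arc_orient_of e (vin false i j.-1 ltac:(lia) ltac:(lia) ltac:(rewrite /=;
        lia)).
    by rewrite /edge_arc /= prednK //; lia.
  have -> : right_rightward (orient_of n e) i j = e (horiz i j).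
    by have := edge_arc_orient_of e (vin false i j ltac:(lia) ltac:(lia) ltac:(rewrite /=;
        lia)).
  by case: ifP; rewrite ?mulr1 ?mulr0.
rewrite mulr1; case: ifP => [hl|hl].
  rewrite aboveE.
  by have := edge_arc_orient_of e (vin false i j ltac:(lia) ltac:(lia) ltac:(rewrite /=;
      lia)); rewrite /edge_arc /= => <-.
have -> : right_boundary (node n i j) by rewrite /right_boundary r c; lia.
have -> : left_rightward (orient_of n e) i j = e (horiz i j.-1).
  have := edge_arc_orient_of e (vin false i j.-1 ltac:(lia) ltac:(lia) ltac:(rewrite /=; lia)).
  by rewrite /edge_arc /= prednK //; lia.
by rewrite aboveE.
Qed.

Lemma prod_vertex_weight e :
  \prod_(x | vertex x) (vertex_weight p q u (orient_of n e) x
     * (bulk x ==> ice (orient_of n e) x)%:R) = \prod_(z <- all_points n) vertex_factor e z.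
Proof.
pose g x := vertex_weight p q u (orient_of n e) x
  * (bulk x ==> ice (orient_of n e) x)%:R.
pose nd (z : nat * nat) := node n z.1 z.2.
have und : uniq (map nd (all_points n)).
  rewrite map_inj_in_uniq ?uniq_all_points // => -[i j] [i' j'].
  rewrite !mem_all_points /nd /= => h h' E.
  move: (congr1 (fun x : grid n => nat_of_ord x.1) E) (congr1 (fun x : grid n => nat_of_ord
      x.2) E).
  by rewrite /= !inordK; try lia; move=> -> ->.
transitivity (\prod_(x <- map nd (all_points n)) g x); last first.
  rewrite big_map; apply: eq_big_seq => -[i j] hij.
  exact: vertex_weight_orient_of.
rewrite big_uniq //= big_mkcond [RHS]big_mkcond; apply: eq_bigr => x _.
have xin : (x \in map nd (all_points n)) = (0 < x.1 <= n)%N && (x.1 <= x.2 <= 2 * n + 2 -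
    x.1)%N.
  apply/mapP/idP => [[[i j] h ->]|h].
    by rewrite mem_all_points in h; rewrite /nd /= !inordK; lia.
  by exists (nat_of_ord x.1, nat_of_ord x.2); rewrite ?mem_all_points // /nd /= -(@nodeE _ x).
rewrite xin; case: ifP => vx; case: ifP => hx //; last first.
  by move: vx hx; rewrite /vertex; move: (nat_of_ord x.1) (nat_of_ord x.2) => a b; lia.
rewrite /g /vertex_weight.
have -> : bulk x = false.
  by apply/negbTE/negP; move: vx hx; rewrite /vertex /bulk; move: (nat_of_ord x.1)
      (nat_of_ord x.2) => a b; lia.
have -> : left_boundary x = false.
  by apply/negbTE/negP; move: vx hx; rewrite /vertex /left_boundary; move: (nat_of_ord x.1)
      (nat_of_ord x.2) => a b; lia.
have -> : right_boundary x = false.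
  by apply/negbTE/negP; move: vx hx; rewrite /vertex /right_boundary; move: (nat_of_ord
      x.1) (nat_of_ord x.2) => a b; lia.
by rewrite mulr1.
Qed.

Lemma Z_ASTE : Z_AST p q n u = sum_bool (Z_end q p (u n.+1) (rows u n)).
Proof.
(* Every edge read by the summand is bound by the sum, so any starting environment serves. *)
rewrite -(isum_all_vars _ _ _ _ (fun=> true)).
rewrite /Z_AST.
(* The local conditions of a configuration become 0-1 factors, so that the sum runs over all
   orientations. *)
transitivity (\sum_(A : {set grid n * grid n} | orientation A)
   (\prod_(x | vertex x) (vertex_weight p q u A x * (bulk x ==> ice A x)%:R)) * (top_up A)%:R).
  rewrite [LHS]big_mkcond [RHS]big_mkcond; apply: eq_bigr => A _.
  rewrite /configuration -/(top_up A); case: (orientation A) => //=.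
  case: (top_up A); rewrite ?andbT ?andbF ?mulr1 ?mulr0 //.
  case: forallP => [h|h].
    apply: eq_bigr => x _; have -> : bulk x ==> ice A x by exact: h.
    by rewrite mulr1.
  have /existsP[x] : [exists x, ~~ (bulk x ==> ice A x)].
    by rewrite -negb_forall; apply/negP => /forallP.
  move=> hx; have vx : vertex x.
    move: hx; rewrite negb_imply => /andP[hb _]; move: hb; rewrite /bulk /vertex.
    move: (nat_of_ord x.1) (nat_of_ord x.2) => a b; lia.
  by rewrite (bigD1 x) //= (negbTE hx) mulr0 mul0r.
rewrite (big_orientation_isum _ (fun=> true)).
apply: eq_isum => e _.
by rewrite prod_vertex_weight top_up_orient_of weight_prod prod_ind.
Qed.

End Products.

(** * Specialization to indeterminates *)

Section Rows.
Variables (F : fieldType) (u : nat -> F).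

Lemma nth_rows n k : (k < n)%N -> (rows u n)`_k = u (n - k)%N.
Proof. by elim: n k => [|n IH] [|k] //= kn; rewrite IH. Qed.

Lemma prod_rows n (f : F -> F) : \prod_(1 <= j < n.+1) f (u j) = \prod_(v <- rows u n) f v.
Proof.
elim: n => [|n IH]; first by rewrite big_geq // big_nil.
by rewrite big_nat_recr //= IH big_cons mulrC.
Qed.

Lemma prod_pairs_rows n : \prod_(1 <= i < n.+1) \prod_(i.+1 <= j < n.+1)
  sigma (u i * (u j)^-1) ^+ 2 = disc (rows u n).
Proof.
elim: n => [|n IH]; first by rewrite big_geq.
rewrite big_nat_recr //= [X in _ * X]big_geq // mulr1 -IH.
rewrite -(prod_rows n (fun v => sigma (u n.+1 * v^-1) ^+ 2)) -big_split /=.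
rewrite big_nat_cond [RHS]big_nat_cond; apply: eq_bigr => i /andP[/andP[i0 iN] _].
rewrite big_nat_recr //= mulrC; congr (_ * _).
(* [disc] puts the larger index first; the square absorbs the sign. *)
by rewrite -[LHS]sqrrN -sigmaV invfM invrK mulrC.
Qed.

(** [rows] lists the indices downwards, so rows and columns are both reversed and the two signs
    cancel. *)
Lemma det_AST_matrix p q n :
  \det (AST_matrix p q n u) =
  \det (AST_mx q n (u n.+1 :: rows u n)
    (fun t => last_row p true (u n.+1) t + last_row p false (u n.+1) t)).
Proof.
set M := AST_mx _ _ _ _.
pose s := perm (@rev_ord_inj n.+1).
have -> : AST_matrix p q n u = row_perm s (col_perm s M).
  apply/matrixP => i j; rewrite !mxE !permE /=.
  have -> : (rev_ord i == ord0) = ~~ (i < n)%N.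
    by rewrite -val_eqE /=; have := ltn_ord i; lia.
  have e (k : 'I_n.+1) : (u n.+1 :: rows u n)`_(n.+1 - k.+1) = u k.+1.
    rewrite -/(rows u n.+1) nth_rows; last by lia.
    by congr u; have := ltn_ord k; lia.
  by rewrite !e; case: ltnP => _ //=; rewrite div1r.
rewrite row_permE col_permE !det_mulmx !det_perm odd_permV mulrCA -expr2.
by rewrite sqrr_sign mulr1.
Qed.

End Rows.

(** Sum of [Z_side_eq] over the two orientations of the bottom edge, the determinant being additive
    in its row 0. *)
Lemma Z_AST_generic (F : fieldType) (p q : F) n (u : nat -> F) :
  q != 0 -> sigma (q ^+ 4) != 0 -> generic q p (rows u n) -> u n.+1 != 0 ->
  {in rows u n, forall v, sigma_pair q v (u n.+1) != 0} ->
  {in rows u n, forall v, sigma (v * (u n.+1)^-1) != 0} ->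
  disc (rows u n) != 0 ->
  Z_AST p q n u =
    ((\prod_(1 <= j < n.+1) sigma (p^-1 * u j))
     * \prod_(1 <= i < n.+1) \prod_(1 <= j < n.+2)
         (sigma (q ^+ 2 * u i * u j) * sigma (q ^+ 2 * (u i)^-1 * (u j)^-1)))
    / (sigma (q ^+ 2) ^+ (2 * n) * sigma (q ^+ 4) ^+ (n * (n - 1))
       * (\prod_(1 <= i < n.+1) sigma (u i * (u n.+1)^-1))
       * \prod_(1 <= i < n.+1) \prod_(i.+1 <= j < n.+1)
           sigma (u i * (u j)^-1) ^+ 2)
    * \det (AST_matrix p q n u).
Proof.
move=> q0 sq4 g x0 sx tx d0; have s2 := sigma_q2_neq0 q0 sq4.
rewrite prod_pairs_rows (prod_rows _ _ (fun v => sigma (p^-1 * v))).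
rewrite (prod_rows _ _ (fun v => sigma (v * (u n.+1)^-1))).
have -> : \prod_(1 <= i < n.+1) \prod_(1 <= j < n.+2)
         (sigma (q ^+ 2 * u i * u j) * sigma (q ^+ 2 * (u i)^-1 * (u j)^-1)) =
   (\prod_(v <- rows u n) \prod_(w <- rows u n) sigma_pair q v w)
   * \prod_(v <- rows u n) sigma_pair q v (u n.+1).
  rewrite (prod_rows _ _ (fun v => \prod_(1 <= j < n.+2) sigma_pair q v (u j))) -big_split /=.
  apply: eq_bigr => v _; rewrite big_nat_recr //=; congr (_ * _).
  exact: (prod_rows _ _ (sigma_pair q v)).
rewrite det_AST_matrix (@det_AST_mx_lin _ _ _ _ 1 1 _ (last_row p true (u n.+1)) (last_row
    p false (u n.+1)));
  last by move=> j; rewrite !mul1r.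
rewrite Z_ASTE.
have E e : Z_end q p (u n.+1) (rows u n) e *
   (sigma (q ^+ 2) ^+ (2 * n) * sigma (q ^+ 4) ^+ (n * (n - 1))) * disc (rows u n) *
   \prod_(v <- rows u n) sigma (v * (u n.+1)^-1) =
   (\prod_(v <- rows u n) sigma (p^-1 * v)) * (\prod_(v <- rows u n) \prod_(w <- rows u n)
       sigma_pair q v w)
   * (\prod_(v <- rows u n) sigma_pair q v (u n.+1) *
      \det (AST_mx q n (u n.+1 :: rows u n) (last_row p e (u n.+1)))).
  have := Z_side_eq q0 sq4 g e x0; rewrite /Z_side /det_side size_rows subn1 => ->.
  congr (_ * _); rewrite -[in X in cleared_mx _ _ _ _ X](erefl : (u n.+1 :: rows u n)`_0 =
      u n.+1).
  rewrite det_cleared_mxE; last first.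
    move=> [[|l] hl] //= _; apply: sx; apply: mem_nth; by rewrite size_rows.
  by have := prod_ord_seq (fun v => sigma_pair q v (u n.+1)) (u n.+1) (rows u n); rewrite
      size_rows => ->.
have P0 : \prod_(v <- rows u n) sigma (v * (u n.+1)^-1) != 0.
  by rewrite prodf_seq_neq0; apply/allP => v /tx.
have [T2 T4] : sigma (q ^+ 2) ^+ (2 * n) != 0 /\ sigma (q ^+ 4) ^+ (n * (n - 1)) != 0.
  by rewrite !expf_neq0.
move: (E true) (E false); rewrite /sum_bool.
move: (sigma _ ^+ (2 * n)) (sigma _ ^+ (n * (n - 1))) T2 T4 => a b a0 b0.
move: (disc _) d0 (\prod_(v <- rows u n) sigma (v * _)) P0 => d d0 P P0.
set Zt := Z_end _ _ _ _ true; set Zf := Z_end _ _ _ _ false.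
move=> Et Ef; have N0 : a * b * d * P != 0 by rewrite !mulf_neq0.
apply: (mulIf N0); rewrite mulrDl.
have -> : Zt * (a * b * d * P) = Zt * (a * b) * d * P by ring.
have -> : Zf * (a * b * d * P) = Zf * (a * b) * d * P by ring.
rewrite Et Ef; field; by rewrite a0 b0 d0 P0.
Qed.

Section Indeterminates.
Variables (K : fieldType) (n : nat).
Notation F := (ratfun K n).
Notation U k := (U_(inord k : 'I_n.+3))%MM.

Definition monomial (m : 'X_{1..n.+3}) : F := @tofrac {mpoly K[n.+3]} 'X_[m].

Lemma monomial_inj : injective monomial.
Proof.
move=> m m' /eqP; rewrite /monomial tofrac_eq => /eqP /mpolyP h.
have := h m; rewrite !mcoeffX eqxx; case: eqP => // _ /eqP.
by rewrite oner_eq0.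
Qed.

Lemma monomialD m m' : monomial (m + m')%MM = monomial m * monomial m'.
Proof. by rewrite /monomial mpolyXD rmorphM. Qed.

Lemma monomial0 : monomial 0%MM = 1.
Proof. by rewrite /monomial mpolyX0 rmorph1. Qed.

Lemma monomial_neq0 m : monomial m != 0.
Proof.
rewrite /monomial tofrac_eq0; apply/eqP => /mpolyP/(_ m)/eqP.
by rewrite mcoeffX eqxx mcoeff0 oner_eq0.
Qed.

(** A zero of sigma has square 1, so the two monomials would have equal squares; the exponents of
    one variable exclude this. *)
Lemma sigma_monomial_neq0 (m m' : 'X_{1..n.+3}) (k : 'I_n.+3) : m k != m' k ->
  sigma (monomial m / monomial m') != 0.
Proof.
move=> mk; rewrite sigma_eq0 ?mulf_neq0 ?invr_eq0 ?monomial_neq0 //.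
apply: contra mk; rewrite expr_div_n => /eqP/divr1_eq h.
have : monomial (m + m)%MM = monomial (m' + m')%MM.
  by rewrite !monomialD -!expr2.
move=> /monomial_inj /(congr1 (fun m : 'X_{1..n.+3} => m k)); rewrite !mnmDE => e.
by apply/eqP; lia.
Qed.

Lemma sigma_indet_neq0 (z : F) (m m' : 'X_{1..n.+3}) k : z = monomial m / monomial m' ->
  m (inord k) != m' (inord k) -> sigma z != 0.
Proof. by move=> ->; exact: sigma_monomial_neq0. Qed.

Lemma indet_neq0 k : indet K n k != 0.
Proof. exact: monomial_neq0. Qed.

Lemma mnm1_inord k l : (k < n.+3)%N -> (l < n.+3)%N ->
  (U k : 'X_{1..n.+3}) (inord l) = (k == l).
Proof. by move=> hk hl; rewrite mnm1E -val_eqE /= !inordK. Qed.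

Notation p := (p_indet K n).
Notation q := (q_indet K n).
Notation u := (u_indet K n).

Lemma mem_rows (w : F) r : w \in rows u r -> exists2 i, (0 < i <= r)%N & w = u i.
Proof.
elim: r => //= r IH; rewrite inE => /orP[/eqP->|/IH[i hi ->]].
  by exists r.+1; rewrite ?leqnn.
by exists i => //; lia.
Qed.

Lemma sigma_u_u_neq0 i j : (0 < i <= n.+1)%N -> (0 < j <= n.+1)%N -> i != j ->
  sigma (u i * (u j)^-1) != 0.
Proof.
move=> hi hj ij; apply: (sigma_indet_neq0 (k := i.+1) erefl).
rewrite !mnm1_inord; lia.
Qed.

Lemma sigma_p_u_neq0 i : (0 < i <= n.+1)%N -> sigma (p^-1 * u i) != 0.
Proof.
move=> hi; apply: (sigma_indet_neq0 (k := 0) (mulrC _ _)).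
rewrite !mnm1_inord; lia.
Qed.

Lemma sigma_pair_u_u_neq0 i j : (0 < i <= n.+1)%N -> (0 < j <= n.+1)%N -> sigma_pair q (u
    i) (u j) != 0.
Proof.
move=> hi hj; rewrite /sigma_pair mulf_neq0 //.
  apply: (@sigma_indet_neq0 _ (U 1 + U 1 + U i.+1 + U j.+1)%MM 0%MM 1%N).
    by rewrite !monomialD monomial0 divr1.
  rewrite !mnmDE mnm0E !mnm1_inord; lia.
apply: (@sigma_indet_neq0 _ (U 1 + U 1)%MM (U i.+1 + U j.+1)%MM 1%N).
  by rewrite !monomialD invfM mulrA.
rewrite !mnmDE !mnm1_inord; lia.
Qed.

Lemma sigma_q4_u_u_neq0 i j : (0 < i <= n.+1)%N -> (0 < j <= n.+1)%N ->
  sigma (q ^+ 4 * u i * (u j)^-1) != 0.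
Proof.
move=> hi hj.
apply: (@sigma_indet_neq0 _ (U 1 + U 1 + U 1 + U 1 + U i.+1)%MM (U j.+1) 1%N).
  by rewrite !monomialD !exprS expr0 mulr1 !mulrA.
rewrite !mnmDE !mnm1_inord; lia.
Qed.

Lemma sigma_q4_neq0 : sigma (q ^+ 4) != 0.
Proof.
apply: (@sigma_indet_neq0 _ (U 1 + U 1 + U 1 + U 1)%MM 0%MM 1%N).
  by rewrite !monomialD monomial0 divr1 !exprS expr0 mulr1 !mulrA.
rewrite !mnmDE mnm0E !mnm1_inord; lia.
Qed.

Lemma generic_indet : generic q p (rows u n).
Proof.
split.
- split; first exact: indet_neq0.
  by apply/negP => /mem_rows[i _ /eqP]; rewrite eq_sym (negbTE (indet_neq0 _)).
- by move=> _ /mem_rows[i hi ->]; apply: sigma_p_u_neq0; lia.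
- by move=> _ _ /mem_rows[i hi ->] /mem_rows[j hj ->]; apply: sigma_pair_u_u_neq0; lia.
- by move=> _ _ /mem_rows[i hi ->] /mem_rows[j hj ->]; apply: sigma_q4_u_u_neq0; lia.
suff H r : (r <= n)%N -> uniq [seq v ^+ 2 | v <- rows u r] by exact: H.
elim: r => //= r IH hr; rewrite IH ?andbT; last by lia.
apply/mapP => -[_ /mem_rows[j hj ->] e].
have := @sigma_u_u_neq0 r.+1 j ltac:(lia) ltac:(lia) ltac:(lia).
rewrite sigma_eq0 ?mulf_neq0 ?invr_eq0 ?indet_neq0 // expr_div_n e divff ?eqxx //.
by rewrite expf_neq0 // indet_neq0.
Qed.

Lemma disc_indet_neq0 : disc (rows u n) != 0.
Proof.
suff H r : (r <= n)%N -> disc (rows u r) != 0 by exact: H.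
elim: r => [|r IH] hr /=; first exact: oner_neq0.
rewrite mulf_neq0 ?IH //; last by lia.
rewrite prodf_seq_neq0; apply/allP => _ /mem_rows[j hj ->] /=.
by rewrite expf_neq0 // sigma_u_u_neq0; lia.
Qed.

End Indeterminates.

Theorem theorem5p1 (K : fieldType) (charK0 : [pchar K] =i pred0)
    (n : nat) (n_gt0 : (0 < n)%N) :
  let p := p_indet K n in
  let q := q_indet K n in
  let u := u_indet K n in
  Z_AST p q n u =
    ((\prod_(1 <= j < n.+1) sigma (p^-1 * u j))
     * \prod_(1 <= i < n.+1) \prod_(1 <= j < n.+2)
         (sigma (q ^+ 2 * u i * u j) * sigma (q ^+ 2 * (u i)^-1 * (u j)^-1)))
    / (sigma (q ^+ 2) ^+ (2 * n) * sigma (q ^+ 4) ^+ (n * (n - 1))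
       * (\prod_(1 <= i < n.+1) sigma (u i * (u n.+1)^-1))
       * \prod_(1 <= i < n.+1) \prod_(i.+1 <= j < n.+1)
           sigma (u i * (u j)^-1) ^+ 2)
    * \det (AST_matrix p q n u).
Proof.
apply: Z_AST_generic; rewrite ?indet_neq0 ?sigma_q4_neq0 ?disc_indet_neq0 //.
- exact: generic_indet.
- by move=> _ /mem_rows[i hi ->]; apply: sigma_pair_u_u_neq0; lia.
- by move=> _ /mem_rows[i hi ->]; apply: sigma_u_u_neq0; lia.
Qed.
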